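(* Assume the two-group Curie–Weiss model described in the context, with $\alpha_1>0$, $\alpha_2>0$, in the high temperature regime $J_1<\frac{1}{\alpha_1}$, $J_2<\frac{1}{\alpha_2}$, $\bar J^2<\big(\frac{1}{\alpha_1}-J_1\big)\big(\frac{1}{\alpha_2}-J_2\big)$. Then \[ \Big(\frac{1}{\sqrt{N_1}}\sum_{i=1}^{N_1}X_i,\ \frac{1}{\sqrt{N_2}}\sum_{j=1}^{N_2}Y_j\Big)\Longrightarrow \mathcal N\big((0,0),C\big)\qquad(N\to\infty), \] where \[ C=\frac{1}{(1-\alpha_1J_1)(1-\alpha_2J_2)-\alpha_1\alpha_2\bar J^2}\begin{pmatrix}1-\alpha_2J_2 & \sqrt{\alpha_1\alpha_2}\,\bar J\\ \sqrt{\alpha_1\alpha_2}\,\bar J & 1-\alpha_1J_1\end{pmatrix}. \]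
   Context: Two-group Curie–Weiss model: for each $N\in\mathbb N$ let $N_1=N_1(N)$, $N_2=N_2(N)$ be positive integers with $N_1+N_2\le N$, $N_1,N_2\to\infty$, and such that the limits $\alpha_1=\lim_{N\to\infty}N_1/N$, $\alpha_2=\lim_{N\to\infty}N_2/N$ exist. The coupling matrix is $J=\begin{pmatrix}J_1&\bar J\\ \bar J&J_2\end{pmatrix}$ with $J_1,J_2,\bar J>0$ and $\Delta:=J_1J_2-\bar J^2>0$. The spins $X_1,\dots,X_{N_1},Y_1,\dots,Y_{N_2}\in\{-1,1\}$ have joint law \[ \mathbb P(X=x,Y=y)=Z^{-1}\exp\Big(\frac{1}{2N}\Big[J_1\Big(\sum_{i}x_i\Big)^2+J_2\Big(\sum_{j}y_j\Big)^2+2\bar J\Big(\sum_{i}x_i\Big)\Big(\sum_{j}y_j\Big)\Big]\Big), \] $Z$ the normalising constant. $\mathcal N(\mu,C)$ denotes the bivariate normal law with mean $\mu$ and covariance matrix $C$; $\Longrightarrow$ is convergence in distribution. *)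

(* Defs.v *)
From Stdlib Require Import Reals Lra List Classical ClassicalEpsilon.
Import ListNotations.
Open Scope R_scope.

Definition sumR (l : list R) : R := fold_right Rplus 0 l.

Fixpoint configs (n : nat) : list (list R) :=
  match n with
  | O => [ [] ]
  | S k => map (cons 1) (configs k) ++ map (cons (-1)) (configs k)
  end.

Definition sum_configs (n1 n2 : nat) (g : list R -> list R -> R) : R :=
  sumR (map (fun x => sumR (map (fun y => g x y) (configs n2))) (configs n1)).

Definition cw_weight (N : nat) (J1 J2 Jb : R) (x y : list R) : R :=
  exp (/ (2 * INR N) *
       (J1 * (sumR x) ^ 2 + J2 * (sumR y) ^ 2 + 2 * Jb * sumR x * sumR y)).

Definition cw_Z (N n1 n2 : nat) (J1 J2 Jb : R) : R :=
  sum_configs n1 n2 (cw_weight N J1 J2 Jb).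

Definition cw_cdf (N n1 n2 : nat) (J1 J2 Jb : R) (a b : R) : R :=
  sum_configs n1 n2 (fun x y =>
     cw_weight N J1 J2 Jb x y *
     (if Rle_dec (sumR x / sqrt (INR n1)) a then
        if Rle_dec (sumR y / sqrt (INR n2)) b then 1 else 0
      else 0))
  / cw_Z N n1 n2 J1 J2 Jb.

(** Riemann integral on [a,b] (0 if f is not Riemann integrable there). *)
Definition Rint (f : R -> R) (a b : R) : R :=
  match excluded_middle_informative
          (exists pr : Riemann_integrable f a b, True) with
  | left H => RiemannInt (proj1_sig (constructive_indefinite_description _ H))
  | right _ => 0
  end.

(** Density of the centred bivariate normal law with covariance
    matrix [[c11, c12], [c12, c22]] (assumed positive definite). *)
Definition gauss2_density (c11 c12 c22 : R) (x y : R) : R :=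
  let d := c11 * c22 - c12 ^ 2 in
  exp (- (c22 * x ^ 2 - 2 * c12 * x * y + c11 * y ^ 2) / (2 * d))
  / (2 * PI * sqrt d).

Definition is_gauss2_cdf (c11 c12 c22 : R) (a b v : R) : Prop :=
  forall eps, eps > 0 -> exists M0, forall M, M >= M0 ->
    Rabs (Rint (fun x => Rint (fun y => gauss2_density c11 c12 c22 x y) (- M) b)
               (- M) a - v) < eps.

Definition nat_to_infty (u : nat -> nat) : Prop :=
  forall M : nat, exists n0, forall n, (n >= n0)%nat -> (u n >= M)%nat.

Definition C_den (a1 a2 J1 J2 Jb : R) : R :=
  (1 - a1 * J1) * (1 - a2 * J2) - a1 * a2 * Jb ^ 2.
Definition C11 (a1 a2 J1 J2 Jb : R) : R := (1 - a2 * J2) / C_den a1 a2 J1 J2 Jb.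
Definition C12 (a1 a2 J1 J2 Jb : R) : R := sqrt (a1 * a2) * Jb / C_den a1 a2 J1 J2 Jb.
Definition C22 (a1 a2 J1 J2 Jb : R) : R := (1 - a1 * J1) / C_den a1 a2 J1 J2 Jb.

(* Main.v *)
(** The number of spin configurations of a group of [n] with magnetisation [s] is a
    binomial coefficient, so the distribution function is a quotient of two weighted
    sums over a product lattice.  Dividing by the central coefficient (this cancels
    in the quotient, so Stirling's formula is not needed), the binomial weight at
    [x = s / sqrt n] tends to [exp (- x^2 / 2)] and is at most
    [exp (- x^2 / 2 * n / (n + 1))].  In the high temperature regime the quadratic form
    obtained by adding the interaction is eventually uniformly positive definite, so
    the weights are dominated by a product of Cauchy densities.

    A lattice sum is the integral of the integrand composed with rounding down to the
    lattice.  Hence both the convergence of lattice sums and that of integrals over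
    growing boxes follow from one dominated convergence theorem.  Stated along an
    arbitrary filter and for continuous convergence (jointly in the index and the
    variable), its conclusion for the inner variable is its hypothesis for the outer. *)

Require Import Defs.
From Stdlib Require Import Reals ZArith Lra Lia List.
From Stdlib Require Import ClassicalEpsilon FunctionalExtensionality.
From Coquelicot Require Import Coquelicot.
Open Scope R_scope.

Local Ltac continuous_by_derive :=
  apply (ex_derive_continuous (V := R_NormedModule)); auto_derive.

(** * Limits along filters *)

Lemma Rabs_minus_triang (x y z : R) : Rabs (x - y) <= Rabs (x - z) + Rabs (y - z).
Proof. rewrite (Rabs_minus_sym y z). apply Rdist_tri. Qed.

Lemma filterlim_Rplus {T : Type} (F : (T -> Prop) -> Prop) {FF : Filter F}
    (f g : T -> R) (a b : R) :
  filterlim f F (locally a) -> filterlim g F (locally b) ->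
  filterlim (fun t => f t + g t) F (locally (a + b)).
Proof.
  intros Hf Hg. apply (filterlim_comp_2 f g Rplus Hf Hg).
  apply (filterlim_plus (V := R_NormedModule)).
Qed.

Lemma filterlim_Rmult {T : Type} (F : (T -> Prop) -> Prop) {FF : Filter F}
    (f g : T -> R) (a b : R) :
  filterlim f F (locally a) -> filterlim g F (locally b) ->
  filterlim (fun t => f t * g t) F (locally (a * b)).
Proof.
  intros Hf Hg. apply (filterlim_comp_2 f g Rmult Hf Hg).
  apply (filterlim_mult (K := R_AbsRing)).
Qed.

Lemma filterlim_continuous {T : Type} (F : (T -> Prop) -> Prop) (f : T -> R) (h : R -> R) (a : R) :
  continuous h a -> filterlim f F (locally a) -> filterlim (fun t => h (f t)) F (locally (h a)).
Proof. intros Hh Hf. exact (filterlim_comp _ _ _ f h F (locally a) (locally (h a)) Hf Hh). Qed.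

Lemma filterlim_Ropp {T : Type} (F : (T -> Prop) -> Prop) (f : T -> R) (a : R) :
  filterlim f F (locally a) -> filterlim (fun t => - f t) F (locally (- a)).
Proof.
  apply (filterlim_continuous F f Ropp).
  exact (continuous_opp (V := R_NormedModule) (fun z => z) a (continuous_id a)).
Qed.

Lemma filterlim_locally_Rabs {T : Type} (F : (T -> Prop) -> Prop) {FF : Filter F}
    (f : T -> R) (l : R) :
  filterlim f F (locally l) <-> forall eps, 0 < eps -> F (fun t => Rabs (f t - l) < eps).
Proof.
  rewrite (filterlim_locally f l). split.
  - intros H eps Heps. exact (H (mkposreal eps Heps)).
  - intros H eps. apply H, cond_pos.
Qed.

Lemma filter_forall_In {T U : Type} (F : (T -> Prop) -> Prop) {FF : Filter F}
    (P : U -> T -> Prop) (l : list U) :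
  (forall u, F (P u)) -> F (fun t => forall u, In u l -> P u t).
Proof.
  intros HP. induction l as [|u l IH].
  - apply filter_forall. intros t v [].
  - generalize (filter_and _ _ (HP u) IH). apply filter_imp.
    intros t [Hu Hl] v [<-|Hv]; auto.
Qed.

(* Continuous convergence in the sense of Caratheodory. Unlike locally uniform
   convergence, which it implies, it survives rounding of the argument. *)
Definition continuous_convergence {T : Type} (F : (T -> Prop) -> Prop)
    (g : T -> R -> R) (g0 : R -> R) : Prop :=
  forall y, filterlim (fun p : T * R => g (fst p) (snd p))
              (filter_prod F (locally y)) (locally (g0 y)).

Lemma continuous_convergence_ball {T : Type} (F : (T -> Prop) -> Prop) {FF : Filter F}
    (g : T -> R -> R) (g0 : R -> R) (y eps : R) :
  continuous_convergence F g g0 -> 0 < eps ->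
  exists d : posreal,
    F (fun t => forall z, Rabs (z - y) < d -> Rabs (g t z - g0 y) < eps).
Proof.
  intros Hcv Heps.
  destruct (proj1 (filterlim_locally_Rabs _ _ _) (Hcv y) eps Heps) as [Q P HQ [d Hd] HQP].
  exists d. revert HQ. apply filter_imp. intros t Ht z Hz. exact (HQP t z Ht (Hd z Hz)).
Qed.

Lemma continuous_convergence_pointwise {T : Type} (F : (T -> Prop) -> Prop) {FF : Filter F}
    (g : T -> R -> R) (g0 : R -> R) (y : R) :
  continuous_convergence F g g0 -> filterlim (fun t => g t y) F (locally (g0 y)).
Proof.
  intros Hcv. apply (filterlim_locally_Rabs F). intros eps Heps.
  destruct (continuous_convergence_ball F g g0 y eps Hcv Heps) as [d Hd].
  revert Hd. apply filter_imp. intros t Ht. apply Ht.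
  rewrite Rminus_diag, Rabs_R0. apply cond_pos.
Qed.

Lemma continuous_convergence_continuous {T : Type} (F : (T -> Prop) -> Prop) {FF : ProperFilter F}
    (g : T -> R -> R) (g0 : R -> R) :
  continuous_convergence F g g0 -> forall y, continuous g0 y.
Proof.
  intros Hcv y. apply (filterlim_locally_Rabs (locally y)). intros eps Heps.
  destruct (continuous_convergence_ball F g g0 y (eps / 2) Hcv ltac:(lra)) as [d Hd].
  exists d. intros z Hz.
  destruct (filter_ex _ (filter_and _ _ Hd
    (proj1 (filterlim_locally_Rabs F _ _)
       (continuous_convergence_pointwise F g g0 z Hcv) (eps / 2) ltac:(lra)))) as [t [Hy Hz']].
  specialize (Hy z Hz).
  rewrite Rabs_minus_sym in Hy, Hz'.
  pose proof (Rabs_minus_triang (g0 z) (g0 y) (g t z)). lra.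
Qed.

Lemma continuous_convergence_uniform {T : Type} (F : (T -> Prop) -> Prop) {FF : ProperFilter F}
    (g : T -> R -> R) (g0 : R -> R) (u v eps : R) :
  continuous_convergence F g g0 -> 0 < eps ->
  F (fun t => forall y, u <= y <= v -> Rabs (g t y - g0 y) < eps).
Proof.
  intros Hcv Heps.
  assert (Hloc : forall y, exists d : posreal, F (fun t => forall z,
      Rabs (z - y) < d -> Rabs (g t z - g0 z) < eps)).
  { intros y.
    destruct (continuous_convergence_ball F g g0 y (eps / 2) Hcv ltac:(lra)) as [d Hd].
    destruct (proj1 (filterlim_locally_Rabs (locally y) _ _)
      (continuous_convergence_continuous F g g0 Hcv y) (eps / 2) ltac:(lra)) as [d' Hd'].
    exists (mkposreal _ (Rmin_pos d d' (cond_pos d) (cond_pos d'))). revert Hd.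
    apply filter_imp. intros t Ht z Hz. simpl in Hz.
    specialize (Ht z (Rlt_le_trans _ _ _ Hz (Rmin_l _ _))).
    specialize (Hd' z (Rlt_le_trans _ _ _ Hz (Rmin_r _ _))).
    pose proof (Rabs_minus_triang (g t z) (g0 z) (g0 y)). lra. }
  destruct (choice _ Hloc) as [delta Hdelta].
  apply NNPP. intros Hn.
  apply (compactness_list 1 (u, tt) (v, tt) (fun p => delta (fst p))).
  intros [centres Hcover]. apply Hn.
  generalize (filter_forall_In F _ (map fst centres) Hdelta). apply filter_imp.
  intros t Ht y Hy.
  destruct (Hcover (y, tt)) as [[z []] [Hz [_ [Hyz _]]]]; [simpl; tauto|].
  apply (Ht z); [exact (in_map fst centres _ Hz) | exact Hyz].
Qed.

(** * Integrals dominated by the Cauchy density *)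

Definition locally_integrable (f : R -> R) : Prop := forall u v, ex_RInt f u v.

Lemma continuous_locally_integrable (f : R -> R) :
  (forall x, continuous f x) -> locally_integrable f.
Proof. intros Hf u v. apply (ex_RInt_continuous (V := R_CompleteNormedModule)). auto. Qed.

Lemma RInt_Rplus_Chasles (f : R -> R) (a b c : R) :
  locally_integrable f -> RInt f a c = RInt f a b + RInt f b c.
Proof. intros Hf. symmetry. apply (RInt_Chasles f a b c); apply Hf. Qed.

Lemma RInt_Rminus (f g : R -> R) (a b : R) :
  locally_integrable f -> locally_integrable g ->
  RInt f a b - RInt g a b = RInt (fun x => f x - g x) a b.
Proof. intros Hf Hg. symmetry. apply (RInt_minus (V := R_CompleteNormedModule) f g); auto. Qed.

Lemma RInt_Rmult_l (f : R -> R) (k a b : R) :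
  locally_integrable f -> RInt (fun x => k * f x) a b = k * RInt f a b.
Proof. intros Hf. apply (RInt_scal (V := R_CompleteNormedModule) f a b k), Hf. Qed.

Lemma locally_integrable_Rmult_l (f : R -> R) (k : R) :
  locally_integrable f -> locally_integrable (fun x => k * f x).
Proof. intros Hf u v. exact (ex_RInt_scal (V := R_NormedModule) f u v k (Hf u v)). Qed.

Lemma locally_integrable_Rminus (f g : R -> R) :
  locally_integrable f -> locally_integrable g -> locally_integrable (fun x => f x - g x).
Proof. intros Hf Hg u v. exact (ex_RInt_minus (V := R_NormedModule) f g u v (Hf u v) (Hg u v)). Qed.

Definition cauchy_weight (y : R) : R := / (1 + y ^ 2).

Definition cauchy_dominated (K : R) (g : R -> R) : Prop :=
  forall y, Rabs (g y) <= K * cauchy_weight y.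

Lemma one_plus_sqr_ge1 (y : R) : 1 <= 1 + y ^ 2.
Proof. pose proof (pow2_ge_0 y); lra. Qed.

Lemma cauchy_weight_range (y : R) : 0 < cauchy_weight y <= 1.
Proof.
  pose proof (one_plus_sqr_ge1 y). unfold cauchy_weight. split.
  - apply Rinv_0_lt_compat; lra.
  - rewrite <- Rinv_1. apply Rinv_le_contravar; lra.
Qed.

Lemma is_derive_atan (x : R) : is_derive atan x (cauchy_weight x).
Proof. apply is_derive_Reals, derivable_pt_lim_atan. Qed.

Lemma is_RInt_cauchy_weight (a b : R) : is_RInt cauchy_weight a b (atan b - atan a).
Proof.
  apply (is_RInt_derive (V := R_CompleteNormedModule) atan cauchy_weight).
  - intros x _. apply is_derive_atan.
  - intros x _. pose proof (one_plus_sqr_ge1 x). unfold cauchy_weight.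
    continuous_by_derive. lra.
Qed.

Lemma cauchy_dominated_ge0 (K : R) (g : R -> R) : cauchy_dominated K g -> 0 <= K.
Proof.
  intros Hg. pose proof (Rle_trans _ _ _ (Rabs_pos _) (Hg 0)) as HK.
  unfold cauchy_weight in HK. replace (K * / (1 + 0 ^ 2)) with K in HK by field. exact HK.
Qed.

Lemma cauchy_dominated_limit {T : Type} (F : (T -> Prop) -> Prop) {FF : ProperFilter F}
    (g : T -> R -> R) (g0 : R -> R) (K : R) :
  (forall y, filterlim (fun t => g t y) F (locally (g0 y))) ->
  F (fun t => cauchy_dominated K (g t)) -> cauchy_dominated K g0.
Proof.
  intros Hlim Hdom y.
  refine (filterlim_le (F := F) (fun t => Rabs (g t y)) (fun _ => K * cauchy_weight y)
    (Rabs (g0 y)) (K * cauchy_weight y) _ _ _).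
  - revert Hdom. apply filter_imp. auto.
  - apply (filterlim_continuous F _ Rabs); [apply (continuous_Rabs (g0 y))|apply Hlim].
  - apply filterlim_const.
Qed.

Lemma abs_RInt_cauchy_dominated (K : R) (g : R -> R) (u v : R) :
  locally_integrable g -> cauchy_dominated K g ->
  Rabs (RInt g u v) <= K * Rabs (atan v - atan u).
Proof.
  intros Hint Hdom.
  assert (Hord : forall a b, a <= b -> Rabs (RInt g a b) <= K * (atan b - atan a)).
  { intros a b Hab.
    apply (norm_RInt_le (V := R_NormedModule) g (fun y => K * cauchy_weight y) a b); auto.
    - exact (RInt_correct g a b (Hint a b)).
    - exact (is_RInt_scal (V := R_NormedModule) _ a b K _ (is_RInt_cauchy_weight a b)). }
  pose proof (cauchy_dominated_ge0 K g Hdom) as HK.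
  destruct (Rle_dec u v) as [Huv|Huv].
  - eapply Rle_trans; [apply Hord, Huv|]. apply Rmult_le_compat_l; [exact HK|apply Rle_abs].
  - rewrite <- (opp_RInt_swap (V := R_CompleteNormedModule) g v u (Hint v u)).
    unfold opp; simpl. rewrite Rabs_Ropp, Rabs_minus_sym.
    eapply Rle_trans; [apply Hord; lra|]. apply Rmult_le_compat_l; [exact HK|apply Rle_abs].
Qed.

Lemma abs_RInt_le_PI (K : R) (g : R -> R) (u v : R) :
  locally_integrable g -> cauchy_dominated K g -> Rabs (RInt g u v) <= K * PI.
Proof.
  intros Hint Hdom. eapply Rle_trans; [apply abs_RInt_cauchy_dominated; eassumption|].
  apply Rmult_le_compat_l; [exact (cauchy_dominated_ge0 K g Hdom)|].
  pose proof (atan_bound u). pose proof (atan_bound v). apply Rabs_le. lra.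
Qed.

Lemma RInt_change_ends (K : R) (g : R -> R) (u v u' v' : R) :
  locally_integrable g -> cauchy_dominated K g ->
  Rabs (RInt g u v - RInt g u' v') <= K * (Rabs (atan u - atan u') + Rabs (atan v - atan v')).
Proof.
  intros Hint Hdom.
  replace (RInt g u v - RInt g u' v') with (RInt g u u' + RInt g v' v).
  - eapply Rle_trans; [apply Rabs_triang|].
    rewrite Rmult_plus_distr_l, (Rabs_minus_sym (atan u)).
    apply Rplus_le_compat; apply abs_RInt_cauchy_dominated; auto.
  - rewrite (RInt_Rplus_Chasles g u u' v), (RInt_Rplus_Chasles g u' v' v) by exact Hint. ring.
Qed.

Lemma filterlim_atan_p_infty : filterlim atan (Rbar_locally p_infty) (locally (PI / 2)).
Proof.
  apply (filterlim_ext_loc (fun x => PI / 2 - atan (/ x))).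
  { exists 0. intros x Hx. rewrite atan_inv by exact Hx. ring. }
  replace (locally (PI / 2)) with (locally (PI / 2 - atan 0)) by (rewrite atan_0, Rminus_0_r; auto).
  apply (filterlim_continuous (Rbar_locally p_infty) Rinv (fun z => PI / 2 - atan z) 0).
  - continuous_by_derive. auto.
  - apply (filterlim_Rbar_inv p_infty). discriminate.
Qed.

Lemma filterlim_atan (a : Rbar) : exists l, filterlim atan (Rbar_locally a) (locally l).
Proof.
  destruct a as [a| |].
  - exists (atan a). apply continuity_pt_filterlim, derivable_continuous_pt, derivable_pt_atan.
  - exists (PI / 2). exact filterlim_atan_p_infty.
  - exists (- (PI / 2)). apply (filterlim_ext (fun x => - atan (- x))).
    { intros x. rewrite atan_opp. ring. }
    apply (filterlim_Ropp (Rbar_locally m_infty) (fun x => atan (- x))).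
    exact (filterlim_comp _ _ _ Ropp atan _ _ _ (filterlim_Rbar_opp m_infty)
             filterlim_atan_p_infty).
Qed.

Lemma atan_oscillation (a : Rbar) (eps : R) : 0 < eps ->
  exists P, Rbar_locally a P /\ forall u v, P u -> P v -> Rabs (atan u - atan v) < eps.
Proof.
  intros Heps. destruct (filterlim_atan a) as [l Hl].
  exists (fun u => Rabs (atan u - l) < eps / 2). split.
  - apply (proj1 (filterlim_locally_Rabs (Rbar_locally a) _ _) Hl). lra.
  - intros u v Hu Hv. pose proof (Rabs_minus_triang (atan u) (atan v) l). lra.
Qed.

(* At a finite end point the integral is a limit as well; for a locally integrable
   integrand it is the ordinary one. *)
Definition improper_RInt (g : R -> R) (a b : Rbar) : R :=
  RInt_gen g (Rbar_locally a) (Rbar_locally b).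

Lemma improper_RInt_unique (g : R -> R) (a b : Rbar) (l : R) :
  is_RInt_gen g (Rbar_locally a) (Rbar_locally b) l -> improper_RInt g a b = l.
Proof. apply (is_RInt_gen_unique (V := R_CompleteNormedModule)). Qed.

Lemma RInt_ends_oscillation (a b : Rbar) (K eps : R) : 0 <= K -> 0 < eps ->
  exists P, filter_prod (Rbar_locally a) (Rbar_locally b) P /\
    forall g p q, locally_integrable g -> cauchy_dominated K g -> P p -> P q ->
      Rabs (RInt g (fst p) (snd p) - RInt g (fst q) (snd q)) < eps.
Proof.
  intros HK Heps.
  assert (He : 0 < eps / (2 * (K + 1))) by (apply Rdiv_lt_0_compat; lra).
  destruct (atan_oscillation a _ He) as [P [HP Pa]].
  destruct (atan_oscillation b _ He) as [Q [HQ Qb]].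
  exists (fun p => P (fst p) /\ Q (snd p)). split; [exists P Q; auto|].
  intros g p q Hint Hdom [Pp Qp] [Pq Qq].
  eapply Rle_lt_trans; [apply RInt_change_ends; eassumption|].
  specialize (Pa _ _ Pp Pq). specialize (Qb _ _ Qp Qq).
  set (e := eps / (2 * (K + 1))) in *.
  assert (Ee : 2 * (K + 1) * e = eps) by (unfold e; field; lra).
  apply Rle_lt_trans with (K * (e + e)); [apply Rmult_le_compat_l; lra|lra].
Qed.

Lemma filterlim_improper_RInt (K : R) (g : R -> R) (a b : Rbar) :
  locally_integrable g -> cauchy_dominated K g ->
  filterlim (fun p => RInt g (fst p) (snd p))
    (filter_prod (Rbar_locally a) (Rbar_locally b)) (locally (improper_RInt g a b)).
Proof.
  intros Hint Hdom. pose proof (cauchy_dominated_ge0 K g Hdom) as HK.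
  assert (Hex : exists l : R, filterlim (fun p => RInt g (fst p) (snd p))
      (filter_prod (Rbar_locally a) (Rbar_locally b)) (locally l)).
  { apply (filterlim_locally_cauchy (U := R_CompleteSpace)). intros eps.
    destruct (RInt_ends_oscillation a b K eps HK (cond_pos eps)) as [P [HP Hosc]].
    exists P. split; [exact HP|]. intros p q Hp Hq. exact (Hosc g q p Hint Hdom Hq Hp). }
  destruct Hex as [l Hl].
  replace (improper_RInt g a b) with l; [exact Hl|]. symmetry.
  apply improper_RInt_unique. intros P HP. unfold filtermapi.
  apply (filter_imp (fun p => P (RInt g (fst p) (snd p)))); [|exact (Hl P HP)].
  intros p Hp. exists (RInt g (fst p) (snd p)). split; [|exact Hp].
  exact (RInt_correct g _ _ (Hint _ _)).
Qed.

Lemma filterlim_RInt_continuous_convergence {T : Type} (F : (T -> Prop) -> Prop)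
    {FF : ProperFilter F} (g : T -> R -> R) (g0 : R -> R) (u v : R) :
  continuous_convergence F g g0 -> F (fun t => locally_integrable (g t)) ->
  filterlim (fun t => RInt (g t) u v) F (locally (RInt g0 u v)).
Proof.
  intros Hcv Hint.
  pose proof (continuous_locally_integrable g0
    (continuous_convergence_continuous F g g0 Hcv)) as Hint0.
  apply (filterlim_locally_Rabs F). intros eps Heps.
  set (w := Rabs (v - u) + 1).
  assert (Hw : 0 < w) by (pose proof (Rabs_pos (v - u)); unfold w; lra).
  assert (He : 0 < eps / w) by (apply Rdiv_lt_0_compat; assumption).
  generalize (filter_and _ _ Hint
    (continuous_convergence_uniform F g g0 (Rmin u v) (Rmax u v) (eps / w) Hcv He)).
  apply filter_imp. intros t [Ht Hunif].
  rewrite RInt_Rminus by assumption.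
  apply Rle_lt_trans with (Rabs (v - u) * (eps / w)).
  - apply (norm_RInt_le_const_abs (V := R_NormedModule) (fun y => g t y - g0 y) u v).
    + intros y Hy. apply Rlt_le, Hunif, Hy.
    + exact (RInt_correct _ u v (locally_integrable_Rminus _ _ Ht Hint0 u v)).
  - apply Rlt_le_trans with (w * (eps / w)); [|right; field; lra].
    apply Rmult_lt_compat_r; [exact He|unfold w; lra].
Qed.

Theorem filterlim_RInt_dominated {T : Type} (F : (T -> Prop) -> Prop) {FF : ProperFilter F}
    (g : T -> R -> R) (g0 : R -> R) (u v : T -> R) (a b : Rbar) (K : R) :
  filterlim u F (Rbar_locally a) -> filterlim v F (Rbar_locally b) ->
  continuous_convergence F g g0 ->
  F (fun t => locally_integrable (g t)) -> F (fun t => cauchy_dominated K (g t)) ->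
  filterlim (fun t => RInt (g t) (u t) (v t)) F (locally (improper_RInt g0 a b)).
Proof.
  intros Hu Hv Hcv Hint Hdom.
  pose proof (continuous_locally_integrable g0
    (continuous_convergence_continuous F g g0 Hcv)) as Hint0.
  pose proof (cauchy_dominated_limit F g g0 K
    (fun y => continuous_convergence_pointwise F g g0 y Hcv) Hdom) as Hdom0.
  apply (filterlim_locally_Rabs F). intros eps Heps.
  assert (He : 0 < eps / 3) by lra.
  destruct (RInt_ends_oscillation a b K (eps / 3) (cauchy_dominated_ge0 _ _ Hdom0) He)
    as [P [HP Hosc]].
  destruct (filter_ex _ (filter_and _ _ HP (proj1 (filterlim_locally_Rabs _ _ _)
    (filterlim_improper_RInt K g0 a b Hint0 Hdom0) (eps / 3) He))) as [q [Hq Hlim]].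
  assert (Huv : F (fun t => P (u t, v t))).
  { apply (filterlim_pair u v Hu Hv). exact HP. }
  generalize (filter_and _ _ (filter_and _ _ Huv (filter_and _ _ Hint Hdom))
    (proj1 (filterlim_locally_Rabs F _ _)
      (filterlim_RInt_continuous_convergence F g g0 (fst q) (snd q) Hcv Hint) (eps / 3) He)).
  apply filter_imp. intros t [[Ht [Hti Htd]] Hfix].
  specialize (Hosc (g t) (u t, v t) q Hti Htd Ht Hq). simpl in Hosc.
  set (x := RInt (g t) (u t) (v t)) in *. set (y := RInt (g t) (fst q) (snd q)) in *.
  set (z := RInt g0 (fst q) (snd q)) in *.
  replace (x - improper_RInt g0 a b)
    with ((x - y) + ((y - z) + (z - improper_RInt g0 a b))) by ring.
  pose proof (Rabs_triang (x - y) ((y - z) + (z - improper_RInt g0 a b))).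
  pose proof (Rabs_triang (y - z) (z - improper_RInt g0 a b)). lra.
Qed.

(** * Lattice sums *)

Record lattice : Type := Lattice { origin : R; mesh : R; steps : nat }.

Definition node (L : lattice) (k : nat) : R := origin L + INR k * mesh L.

Definition indicator_upto (b : Rbar) (x : R) : R := if Rbar_le_dec x b then 1 else 0.

Definition lattice_sum (L : lattice) (b : Rbar) (g : R -> R) : R :=
  mesh L * sum_f_R0 (fun k => g (node L k) * indicator_upto b (node L k)) (steps L).

Lemma indicator_upto_Finite (b x : R) : indicator_upto b x = if Rle_dec x b then 1 else 0.
Proof. unfold indicator_upto. destruct (Rbar_le_dec x b), (Rle_dec x b); simpl in *; tauto. Qed.

Lemma indicator_upto_p_infty (x : R) : indicator_upto p_infty x = 1.
Proof.
  unfold indicator_upto. destruct (Rbar_le_dec x p_infty) as [_|Hx]; [reflexivity|].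
  exfalso. exact (Hx I).
Qed.

Lemma lattice_sum_Rmult_l (L : lattice) (b : Rbar) (k : R) (g : R -> R) :
  lattice_sum L b (fun x => k * g x) = k * lattice_sum L b g.
Proof.
  unfold lattice_sum. set (S := sum_f_R0 (fun i => g (node L i) * _) _).
  replace (k * (mesh L * S)) with (mesh L * (k * S)) by ring.
  f_equal. unfold S. rewrite scal_sum. apply sum_eq. intros i _. ring.
Qed.

Definition refines {T : Type} (F : (T -> Prop) -> Prop) (L : T -> lattice) : Prop :=
  filterlim (fun t => origin (L t)) F (Rbar_locally m_infty) /\
  filterlim (fun t => node (L t) (S (steps (L t)))) F (Rbar_locally p_infty) /\
  filterlim (fun t => mesh (L t)) F (at_right 0).

Lemma refines_comp {T U : Type} (F : (T -> Prop) -> Prop) (G : (U -> Prop) -> Prop)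
    (L : T -> lattice) (phi : U -> T) :
  filterlim phi G F -> refines F L -> refines G (fun u => L (phi u)).
Proof.
  intros Hphi [Ho [He Hm]].
  split; [|split].
  - exact (filterlim_comp _ _ _ phi (fun t => origin (L t)) _ _ _ Hphi Ho).
  - exact (filterlim_comp _ _ _ phi (fun t => node (L t) (S (steps (L t)))) _ _ _ Hphi He).
  - exact (filterlim_comp _ _ _ phi (fun t => mesh (L t)) _ _ _ Hphi Hm).
Qed.

Section LatticeFloor.

Variable L : lattice.
Hypothesis mesh_pos : 0 < mesh L.

Definition node_floor (y : R) : R := origin L + IZR (Int_part ((y - origin L) / mesh L)) * mesh L.

Lemma node_floor_bounds (y : R) : y - mesh L < node_floor y <= y.
Proof.
  unfold node_floor. set (q := (y - origin L) / mesh L).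
  assert (Ey : y = origin L + q * mesh L) by (unfold q; field; lra).
  destruct (base_Int_part q). clearbody q. nra.
Qed.

Lemma node_floor_cell (k : nat) (y : R) :
  node L k <= y < node L (S k) -> node_floor y = node L k.
Proof.
  unfold node, node_floor. rewrite S_INR. intros Hy.
  set (q := (y - origin L) / mesh L).
  assert (Ey : y = origin L + q * mesh L) by (unfold q; field; lra).
  clearbody q. rewrite <- (Int_part_spec q (Z.of_nat k)) by (rewrite <- INR_IZR_INZ; nra).
  rewrite <- INR_IZR_INZ. reflexivity.
Qed.

Lemma is_RInt_node_floor_cell (g : R -> R) (k : nat) :
  is_RInt (fun y => g (node_floor y)) (node L k) (node L (S k)) (mesh L * g (node L k)).
Proof.
  assert (Hnode : node L (S k) - node L k = mesh L) by (unfold node; rewrite S_INR; ring).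
  rewrite <- Hnode at 1.
  apply is_RInt_ext with (f := fun _ => g (node L k)).
  - rewrite Rmin_left, Rmax_right by lra. intros y Hy.
    rewrite (node_floor_cell k) by lra. reflexivity.
  - exact (is_RInt_const (V := R_NormedModule) _ _ _).
Qed.

Fixpoint nodes_below (b : Rbar) (n : nat) : nat :=
  match n with
  | O => O
  | S k => if Rbar_le_dec (node L k) b then n else nodes_below b k
  end.

Lemma node_monotone (j k : nat) : (j <= k)%nat -> node L j <= node L k.
Proof. intros Hjk. apply le_INR in Hjk. unfold node. nra. Qed.

Lemma nodes_below_full (b : Rbar) (n : nat) : Rbar_le (node L n) b -> nodes_below b n = n.
Proof.
  destruct n as [|n]; intros Hn; [reflexivity|]. simpl.
  destruct (Rbar_le_dec (node L n) b) as [H|H]; [reflexivity|].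
  exfalso. apply H. eapply Rbar_le_trans; [|exact Hn]. apply (node_monotone n (S n)). lia.
Qed.

Lemma is_RInt_node_floor (b : Rbar) (g : R -> R) (n : nat) :
  is_RInt (fun y => g (node_floor y)) (origin L) (node L (nodes_below b (S n)))
    (mesh L * sum_f_R0 (fun k => g (node L k) * indicator_upto b (node L k)) n).
Proof.
  assert (Hterm : forall k, is_RInt (fun y => g (node_floor y)) (node L k)
      (node L (if Rbar_le_dec (node L k) b then S k else k))
      (mesh L * (g (node L k) * indicator_upto b (node L k)))).
  { intros k. unfold indicator_upto. destruct (Rbar_le_dec (node L k) b) as [H|H].
    - rewrite Rmult_1_r. apply is_RInt_node_floor_cell.
    - rewrite !Rmult_0_r. exact (is_RInt_point (V := R_NormedModule) _ _). }
  induction n as [|n IH].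
  - replace (origin L) with (node L 0) by (unfold node; simpl; ring). exact (Hterm O).
  - rewrite tech5, Rmult_plus_distr_l.
    apply (is_RInt_Chasles (V := R_NormedModule) _ _ (node L (nodes_below b (S n)))); [exact IH|].
    specialize (Hterm (S n)). unfold indicator_upto in *.
    change (nodes_below b (S (S n))) with
      (if Rbar_le_dec (node L (S n)) b then S (S n) else nodes_below b (S n)).
    destruct (Rbar_le_dec (node L (S n)) b) as [H|H].
    + rewrite nodes_below_full by exact H. exact Hterm.
    + rewrite !Rmult_0_r. exact (is_RInt_point (V := R_NormedModule) _ _).
Qed.

Lemma nodes_below_end (b : Rbar) (n : nat) :
  (nodes_below b n = n \/ Rbar_lt b (node L (nodes_below b n))) /\
  (nodes_below b n = O \/ Rbar_le (node L (nodes_below b n) - mesh L) b).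
Proof.
  induction n as [|n [Hlow Hup]]; [auto|]. simpl.
  destruct (Rbar_le_dec (node L n) b) as [H|H].
  - split; [auto|right]. unfold node in *. rewrite S_INR.
    replace (origin L + (INR n + 1) * mesh L - mesh L) with (origin L + INR n * mesh L) by ring.
    exact H.
  - split; [right|exact Hup]. destruct Hlow as [-> | Hlow]; [|exact Hlow].
    apply Rbar_not_le_lt, H.
Qed.

Definition sum_end (b : Rbar) : R := node L (nodes_below b (S (steps L))).

Lemma cauchy_dominated_node_floor (K : R) (g : R -> R) :
  mesh L <= 1 -> cauchy_dominated K g -> cauchy_dominated (3 * K) (fun y => g (node_floor y)).
Proof.
  intros Hm Hg y. pose proof (cauchy_dominated_ge0 K g Hg) as HK.
  eapply Rle_trans; [apply Hg|].
  pose proof (node_floor_bounds y) as Hz. set (z := node_floor y) in *.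
  replace (3 * K * cauchy_weight y) with (K * (3 * cauchy_weight y)) by ring.
  apply Rmult_le_compat_l; [exact HK|]. unfold cauchy_weight.
  pose proof (one_plus_sqr_ge1 y). pose proof (one_plus_sqr_ge1 z).
  assert (1 + y ^ 2 <= 3 * (1 + z ^ 2)) by (pose proof (pow2_ge_0 (2 * z - y)); nra).
  apply Rmult_le_reg_r with ((1 + z ^ 2) * (1 + y ^ 2)); [nra|].
  field_simplify; lra.
Qed.

End LatticeFloor.

Lemma node_floor_shift (L : lattice) (m n : nat) (y : R) : 0 < mesh L ->
  node_floor (Lattice (origin L - INR m * mesh L) (mesh L) n) y = node_floor L y.
Proof.
  intros Hm. unfold node_floor; simpl.
  replace ((y - (origin L - INR m * mesh L)) / mesh L)
    with ((y - origin L) / mesh L + INR m) by (field; lra).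
  destruct (base_Int_part ((y - origin L) / mesh L)).
  rewrite <- (Int_part_spec _ (Int_part ((y - origin L) / mesh L) + Z.of_nat m))
    by (rewrite plus_IZR, <- INR_IZR_INZ; lra).
  rewrite plus_IZR, <- INR_IZR_INZ. ring.
Qed.

Lemma locally_integrable_node_floor (L : lattice) (g : R -> R) :
  0 < mesh L -> locally_integrable (fun y => g (node_floor L y)).
Proof.
  intros Hm u v.
  destruct (INR_archimed (mesh L) (origin L - Rmin u v) Hm) as [m Hleft].
  destruct (INR_archimed (mesh L) (Rmax u v - origin L + INR m * mesh L) Hm) as [n Hright].
  set (L' := Lattice (origin L - INR m * mesh L) (mesh L) n).
  assert (Hwide : ex_RInt (fun y => g (node_floor L y)) (origin L') (node L' (S n))).
  { eexists. apply is_RInt_ext with (f := fun y => g (node_floor L' y)).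
    - intros y _. unfold L'. rewrite node_floor_shift by exact Hm. reflexivity.
    - rewrite <- (nodes_below_full L' Hm p_infty (S n)) by exact I.
      apply is_RInt_node_floor, Hm. }
  assert (Hsub : forall w, Rmin u v <= w <= Rmax u v ->
      ex_RInt (fun y => g (node_floor L y)) (origin L') w).
  { intros w Hw. apply (ex_RInt_Chasles_1 (V := R_CompleteNormedModule) _ _ _ (node L' (S n)));
      [|exact Hwide].
    unfold node, L' in *; simpl origin in *; simpl mesh in *. rewrite S_INR. lra. }
  apply ex_RInt_Chasles with (origin L').
  - apply ex_RInt_swap, Hsub. split; [apply Rmin_l|apply Rmax_l].
  - apply Hsub. split; [apply Rmin_r|apply Rmax_r].
Qed.

Lemma lattice_sum_RInt (L : lattice) (b : Rbar) (g : R -> R) : 0 < mesh L ->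
  lattice_sum L b g =
  RInt (fun y => g (node_floor L y)) (origin L) (sum_end L b).
Proof. intros Hm. symmetry. apply is_RInt_unique, is_RInt_node_floor, Hm. Qed.

Lemma abs_lattice_sum_le (L : lattice) (b : Rbar) (g : R -> R) (K : R) :
  0 < mesh L <= 1 -> cauchy_dominated K g -> Rabs (lattice_sum L b g) <= 3 * K * PI.
Proof.
  intros Hm Hg. rewrite lattice_sum_RInt by apply Hm. apply abs_RInt_le_PI.
  - apply locally_integrable_node_floor, Hm.
  - apply cauchy_dominated_node_floor; [apply Hm|apply Hm|exact Hg].
Qed.

Section LatticeLimit.

Context {T : Type} (F : (T -> Prop) -> Prop) {FF : ProperFilter F}.
Variable L : T -> lattice.
Hypothesis L_refines : refines F L.

Lemma refines_mesh (eps : R) : 0 < eps -> F (fun t => 0 < mesh (L t) < eps).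
Proof.
  intros Heps. destruct L_refines as [_ [_ Hm]].
  apply (Hm (fun h => 0 < h < eps)). exists (mkposreal eps Heps). intros h Hh Hpos.
  change (Rabs (h - 0) < eps) in Hh. apply Rabs_lt_between in Hh. lra.
Qed.

Lemma eventually_sum_end_above (b : Rbar) (x : R) : Rbar_lt x b ->
  F (fun t => x < sum_end (L t) b).
Proof.
  intros Hx. destruct L_refines as [_ [He _]].
  assert (Hlast : F (fun t => x < node (L t) (S (steps (L t)))))
    by (apply (He (fun y => x < y)); exists x; auto).
  revert Hlast. apply filter_imp. intros t Ht. unfold sum_end.
  destruct (nodes_below_end (L t) b (S (steps (L t)))) as [[-> | Hb] _]; [exact Ht|].
  exact (Rbar_lt_trans x b _ Hx Hb).
Qed.

Lemma eventually_sum_end_below (b : Rbar) (x : R) : Rbar_lt b x ->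
  F (fun t => sum_end (L t) b < x).
Proof.
  intros Hx. destruct L_refines as [Ho _].
  assert (Hmid : exists x', Rbar_le b (Finite x') /\ x' < x).
  { destruct b as [b| |]; simpl in Hx; [exists b|tauto|exists (x - 1)]; simpl; lra. }
  destruct Hmid as [x' [Hbx' Hx']].
  assert (Hfirst : F (fun t => origin (L t) < x))
    by (apply (Ho (fun y => y < x)); exists x; auto).
  generalize (filter_and _ _ Hfirst (refines_mesh (x - x') ltac:(lra))). apply filter_imp.
  intros t [Ht Hm]. unfold sum_end.
  destruct (nodes_below_end (L t) b (S (steps (L t)))) as [_ [-> | Hb]].
  - unfold node; simpl. lra.
  - pose proof (Rbar_le_trans _ _ _ Hb Hbx') as H. unfold Rbar_le in H. lra.
Qed.

Lemma filterlim_sum_end (b : Rbar) : filterlim (fun t => sum_end (L t) b) F (Rbar_locally b).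
Proof.
  destruct b as [b| |]; intros P [x HP]; unfold filtermap.
  - assert (Hlow : Rbar_lt (b - x) b) by (pose proof (cond_pos x); simpl; lra).
    assert (Hup : Rbar_lt b (b + x)) by (pose proof (cond_pos x); simpl; lra).
    generalize (filter_and _ _ (eventually_sum_end_above b _ Hlow)
      (eventually_sum_end_below b _ Hup)).
    apply filter_imp. intros t Ht. apply HP, Rabs_lt_between.
    unfold minus, plus, opp; simpl. lra.
  - generalize (eventually_sum_end_above p_infty x I). apply filter_imp. auto.
  - generalize (eventually_sum_end_below m_infty x I). apply filter_imp. auto.
Qed.

Lemma continuous_convergence_node_floor (g : T -> R -> R) (g0 : R -> R) :
  continuous_convergence F g g0 ->
  continuous_convergence F (fun t y => g t (node_floor (L t) y)) g0.
Proof.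
  intros Hg y. apply (filterlim_comp_2 (G := F) (H := locally y) fst
    (fun p : T * R => node_floor (L (fst p)) (snd p)) g filterlim_fst); [|exact (Hg y)].
  apply (filterlim_locally_Rabs (filter_prod F (locally y))). intros eps Heps.
  exists (fun t => 0 < mesh (L t) < eps / 2) (fun z => Rabs (z - y) < eps / 2).
  - apply refines_mesh. lra.
  - exists (mkposreal (eps / 2) ltac:(lra)). auto.
  - intros t z [Hpos Hm] Hz. simpl. pose proof (node_floor_bounds (L t) Hpos z).
    apply Rabs_lt_between. apply Rabs_lt_between in Hz. lra.
Qed.

Theorem lattice_sum_cv (g : T -> R -> R) (g0 : R -> R) (K : R) (b : Rbar) :
  continuous_convergence F g g0 -> F (fun t => cauchy_dominated K (g t)) ->
  filterlim (fun t => lattice_sum (L t) b (g t)) F (locally (improper_RInt g0 m_infty b)).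
Proof.
  intros Hcv Hdom. pose proof (refines_mesh 1 Rlt_0_1) as Hmesh.
  apply (filterlim_ext_loc (fun t => RInt (fun y => g t (node_floor (L t) y))
    (origin (L t)) (sum_end (L t) b))).
  { revert Hmesh. apply filter_imp. intros t Ht. symmetry. apply lattice_sum_RInt, Ht. }
  apply (filterlim_RInt_dominated F (fun t y => g t (node_floor (L t) y)) g0
    (fun t => origin (L t)) (fun t => sum_end (L t) b) m_infty b (3 * K)).
  - apply L_refines.
  - apply filterlim_sum_end.
  - apply continuous_convergence_node_floor, Hcv.
  - revert Hmesh. apply filter_imp. intros t Ht. apply locally_integrable_node_floor, Ht.
  - generalize (filter_and _ _ Hmesh Hdom). apply filter_imp. intros t [Ht Hd].
    apply cauchy_dominated_node_floor; [apply Ht|lra|exact Hd].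
Qed.

End LatticeLimit.

(** * Iterated limits *)

Lemma cauchy_dominated_weaken (K K' : R) (g : R -> R) :
  K <= K' -> cauchy_dominated K g -> cauchy_dominated K' g.
Proof.
  intros HK Hg y. eapply Rle_trans; [apply Hg|].
  pose proof (cauchy_weight_range y). apply Rmult_le_compat_r; lra.
Qed.

Lemma continuous_convergence_comp {T U : Type} (F : (T -> Prop) -> Prop) (G : (U -> Prop) -> Prop)
    {FG : Filter G} (phi : U -> T) (g : T -> R -> R) (g0 : R -> R) :
  filterlim phi G F -> continuous_convergence F g g0 ->
  continuous_convergence G (fun u => g (phi u)) g0.
Proof.
  intros Hphi Hg y. apply (filterlim_comp_2 (G := F) (H := locally y)
    (fun p : U * R => phi (fst p)) snd g).
  - exact (filterlim_comp _ _ _ fst phi _ G F filterlim_fst Hphi).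
  - exact filterlim_snd.
  - exact (Hg y).
Qed.

Definition improper_RInt2 (f : R -> R -> R) (b1 b2 : Rbar) : R :=
  improper_RInt (fun x => improper_RInt (f x) m_infty b2) m_infty b1.

Definition cauchy_dominated2 (K : R) (f : R -> R -> R) : Prop :=
  forall x, cauchy_dominated (K * cauchy_weight x) (f x).

Definition continuous_convergence2 {T : Type} (F : (T -> Prop) -> Prop)
    (f : T -> R -> R -> R) (f0 : R -> R -> R) : Prop :=
  forall x, continuous_convergence (filter_prod F (locally x))
              (fun p : T * R => f (fst p) (snd p)) (f0 x).

Lemma cauchy_dominated2_row (K : R) (f : R -> R -> R) (x : R) :
  cauchy_dominated2 K f -> cauchy_dominated K (f x).
Proof.
  intros Hf. apply cauchy_dominated_weaken with (2 := Hf x).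
  assert (HK : 0 <= K).
  { pose proof (cauchy_dominated_ge0 _ _ (Hf 0)) as H. unfold cauchy_weight in H.
    replace (K * / (1 + 0 ^ 2)) with K in H by field. exact H. }
  rewrite <- (Rmult_1_r K) at 2. apply Rmult_le_compat_l; [exact HK|apply cauchy_weight_range].
Qed.

Theorem lattice_sum2_cv {T : Type} (F : (T -> Prop) -> Prop) {FF : ProperFilter F}
    (L1 L2 : T -> lattice) (f : T -> R -> R -> R) (f0 : R -> R -> R) (K : R) (b1 b2 : Rbar) :
  refines F L1 -> refines F L2 ->
  continuous_convergence2 F f f0 -> F (fun t => cauchy_dominated2 K (f t)) ->
  filterlim (fun t => lattice_sum (L1 t) b1 (fun x => lattice_sum (L2 t) b2 (f t x))) F
    (locally (improper_RInt2 f0 b1 b2)).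
Proof.
  intros HL1 HL2 Hcv Hdom.
  apply (lattice_sum_cv F L1 HL1 (fun t x => lattice_sum (L2 t) b2 (f t x))
    (fun x => improper_RInt (f0 x) m_infty b2) (3 * K * PI)).
  - intros x. apply (lattice_sum_cv (filter_prod F (locally x)) (fun p => L2 (fst p))
      (refines_comp F _ L2 fst filterlim_fst HL2) (fun p => f (fst p) (snd p)) (f0 x) K).
    + apply Hcv.
    + exists (fun t => cauchy_dominated2 K (f t)) (fun _ => True); [exact Hdom|apply filter_true|].
      intros t z Ht _. apply cauchy_dominated2_row, Ht.
  - generalize (filter_and _ _ (refines_mesh F L2 HL2 1 Rlt_0_1) Hdom). apply filter_imp.
    intros t [Hm Ht] x. replace (3 * K * PI * cauchy_weight x)
      with (3 * (K * cauchy_weight x) * PI) by ring.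
    apply abs_lattice_sum_le; [lra|apply Ht].
Qed.

Definition jointly_continuous (f : R -> R -> R) : Prop :=
  forall x, continuous_convergence (locally x) f (f x).

Lemma jointly_continuous_row (f : R -> R -> R) (x : R) :
  jointly_continuous f -> locally_integrable (f x).
Proof.
  intros Hf. apply continuous_locally_integrable.
  exact (continuous_convergence_continuous (locally x) f (f x) (Hf x)).
Qed.

Lemma jointly_continuous_RInt (f : R -> R -> R) (u v : R) :
  jointly_continuous f -> locally_integrable (fun x => RInt (f x) u v).
Proof.
  intros Hf. apply continuous_locally_integrable. intros x.
  apply (filterlim_RInt_continuous_convergence (locally x) f (f x) u v (Hf x)).
  apply filter_forall. intros z. apply jointly_continuous_row, Hf.
Qed.

Theorem RInt_box_cv (f : R -> R -> R) (K a b : R) :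
  jointly_continuous f -> cauchy_dominated2 K f ->
  filterlim (fun M => RInt (fun x => RInt (f x) (- M) b) (- M) a) (Rbar_locally p_infty)
    (locally (improper_RInt2 f a b)).
Proof.
  intros Hf Hdom.
  apply (filterlim_RInt_dominated (Rbar_locally p_infty) (fun M x => RInt (f x) (- M) b)
    (fun x => improper_RInt (f x) m_infty b) Ropp (fun _ => a) m_infty a (K * PI)).
  - exact (filterlim_Rbar_opp p_infty).
  - apply filterlim_const.
  - intros x. apply (filterlim_RInt_dominated (filter_prod (Rbar_locally p_infty) (locally x))
      (fun p => f (snd p)) (f x) (fun p => - fst p) (fun _ => b) m_infty b K).
    + exact (filterlim_comp _ _ _ fst Ropp _ _ _ filterlim_fst (filterlim_Rbar_opp p_infty)).
    + apply filterlim_const.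
    + exact (continuous_convergence_comp (locally x) _ snd f (f x) filterlim_snd (Hf x)).
    + apply filter_forall. intros p. apply jointly_continuous_row, Hf.
    + apply filter_forall. intros p. apply cauchy_dominated2_row, Hdom.
  - apply filter_forall. intros M. apply jointly_continuous_RInt, Hf.
  - apply filter_forall. intros M x. replace (K * PI * cauchy_weight x)
      with (K * cauchy_weight x * PI) by ring.
    apply abs_RInt_le_PI; [apply jointly_continuous_row, Hf|apply Hdom].
Qed.

(** * The Gaussian integral *)

Lemma RInt_comp_Rmult (f : R -> R) (u a b : R) : locally_integrable f ->
  RInt f (u * a) (u * b) = RInt (fun y => u * f (u * y)) a b.
Proof.
  intros Hf.
  rewrite <- (Rplus_0_r (u * a)), <- (Rplus_0_r (u * b)).
  rewrite <- (RInt_comp_lin (V := R_CompleteNormedModule) f u 0 a b) by apply Hf.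
  apply RInt_ext. intros y _. rewrite Rplus_0_r. reflexivity.
Qed.

Definition gauss_primitive (x : R) : R := RInt (fun t => exp (- t ^ 2 / 2)) 0 x.

Lemma locally_integrable_gauss : locally_integrable (fun t => exp (- t ^ 2 / 2)).
Proof.
  apply continuous_locally_integrable. intros x.
  continuous_by_derive. auto.
Qed.

Lemma is_derive_gauss_primitive (x : R) : is_derive gauss_primitive x (exp (- x ^ 2 / 2)).
Proof.
  apply (is_derive_RInt (fun t => exp (- t ^ 2 / 2)) gauss_primitive 0 x).
  - apply filter_forall. intros y. exact (RInt_correct _ 0 y (locally_integrable_gauss 0 y)).
  - continuous_by_derive. auto.
Qed.

Lemma gauss_primitive_opp (x : R) : gauss_primitive (- x) = - gauss_primitive x.
Proof.
  unfold gauss_primitive. replace 0 with (-1 * 0) at 1 by ring. replace (- x) with (-1 * x) by ring.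
  rewrite (RInt_comp_Rmult (fun t => exp (- t ^ 2 / 2))) by exact locally_integrable_gauss.
  rewrite (RInt_Rmult_l (fun t => exp (- (-1 * t) ^ 2 / 2))).
  - rewrite (RInt_ext _ (fun t => exp (- t ^ 2 / 2))); [lra|].
    intros t _. f_equal. field.
  - apply continuous_locally_integrable. intros t.
    continuous_by_derive. auto.
Qed.

(* [gauss_primitive ^ 2 + 2 * gauss_polar] has derivative zero. *)
Definition gauss_polar_integrand (x t : R) : R := exp (- x ^ 2 * (1 + t ^ 2) / 2) * cauchy_weight t.

Definition gauss_polar (x : R) : R := RInt (gauss_polar_integrand x) 0 1.

Lemma continuous_gauss_polar_integrand (x t : R) : continuous (gauss_polar_integrand x) t.
Proof.
  pose proof (one_plus_sqr_ge1 t). unfold gauss_polar_integrand, cauchy_weight.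
  continuous_by_derive. lra.
Qed.

Lemma is_derive_gauss_polar_integrand (x t : R) :
  is_derive (fun u => gauss_polar_integrand u t) x (- x * exp (- x ^ 2 * (1 + t ^ 2) / 2)).
Proof.
  pose proof (one_plus_sqr_ge1 t). unfold gauss_polar_integrand, cauchy_weight.
  auto_derive; [exact I|].
  replace (- (x * (x * 1)) * (1 + t * (t * 1)) * / 2)
    with (- x ^ 2 * (1 + t ^ 2) / 2) by (unfold Rdiv; ring).
  field. lra.
Qed.

Lemma continuity_2d_pt_exp_quadratic (x t : R) :
  continuity_2d_pt (fun u v => - u * exp (- u ^ 2 * (1 + v ^ 2) / 2)) x t.
Proof.
  apply continuity_2d_pt_mult; [apply continuity_2d_pt_opp, continuity_2d_pt_id1|].
  apply (continuity_1d_2d_pt_comp exp (fun u v => - u ^ 2 * (1 + v ^ 2) / 2)).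
  - apply derivable_continuous_pt, derivable_pt_exp.
  - apply (continuity_2d_pt_ext (fun u v => - (u * u) * (1 + v * v) * / 2)).
    + intros; unfold Rdiv; ring.
    + repeat first [apply continuity_2d_pt_mult | apply continuity_2d_pt_plus
        | apply continuity_2d_pt_opp | apply continuity_2d_pt_id1
        | apply continuity_2d_pt_id2 | apply continuity_2d_pt_const].
Qed.

Lemma RInt_gauss_polar_derivative (x : R) :
  RInt (fun t => - x * exp (- x ^ 2 * (1 + t ^ 2) / 2)) 0 1 =
  - exp (- x ^ 2 / 2) * gauss_primitive x.
Proof.
  assert (Hexp : forall t, - x * exp (- x ^ 2 * (1 + t ^ 2) / 2) =
      - exp (- x ^ 2 / 2) * (x * exp (- (x * t) ^ 2 / 2))).
  { intros t. replace (- x ^ 2 * (1 + t ^ 2) / 2) with (- x ^ 2 / 2 + - (x * t) ^ 2 / 2) by field.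
    rewrite exp_plus. ring. }
  replace (gauss_primitive x) with (RInt (fun t => exp (- t ^ 2 / 2)) (x * 0) (x * 1))
    by (unfold gauss_primitive; f_equal; ring).
  rewrite (RInt_comp_Rmult _ x 0 1 locally_integrable_gauss), <- RInt_Rmult_l.
  - apply RInt_ext. intros t _. apply Hexp.
  - apply continuous_locally_integrable. intros t.
    continuous_by_derive. auto.
Qed.

Lemma is_derive_gauss_polar (x : R) :
  is_derive gauss_polar x (- exp (- x ^ 2 / 2) * gauss_primitive x).
Proof.
  assert (Hd : forall u t, Derive (fun u => gauss_polar_integrand u t) u =
      - u * exp (- u ^ 2 * (1 + t ^ 2) / 2)).
  { intros u t. apply is_derive_unique, is_derive_gauss_polar_integrand. }
  rewrite <- RInt_gauss_polar_derivative.
  rewrite <- (RInt_ext (fun t => Derive (fun u => gauss_polar_integrand u t) x))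
    by (intros t _; apply Hd).
  apply (is_derive_RInt_param gauss_polar_integrand 0 1 x).
  - apply filter_forall. intros y t _. eexists. apply is_derive_gauss_polar_integrand.
  - intros t _. apply (continuity_2d_pt_ext (fun u v => - u * exp (- u ^ 2 * (1 + v ^ 2) / 2))).
    + intros u v. symmetry. apply Hd.
    + apply continuity_2d_pt_exp_quadratic.
  - apply filter_forall. intros y.
    apply (continuous_locally_integrable (gauss_polar_integrand y)).
    apply continuous_gauss_polar_integrand.
Qed.

Lemma gauss_polar_0 : gauss_polar 0 = PI / 4.
Proof.
  assert (Hzero : forall t, gauss_polar_integrand 0 t = cauchy_weight t).
  { intros t. unfold gauss_polar_integrand.
    replace (- 0 ^ 2 * (1 + t ^ 2) / 2) with 0 by (unfold Rdiv; ring). rewrite exp_0. ring. }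
  unfold gauss_polar. rewrite (RInt_ext _ cauchy_weight) by (intros t _; apply Hzero).
  rewrite (is_RInt_unique _ _ _ _ (is_RInt_cauchy_weight 0 1)), atan_0, atan_1. ring.
Qed.

Lemma gauss_primitive_sqr (x : R) : 0 <= x -> gauss_primitive x ^ 2 = PI / 2 - 2 * gauss_polar x.
Proof.
  intros Hx.
  assert (Hzero : gauss_primitive 0 = 0)
    by exact (RInt_point (V := R_CompleteNormedModule) 0 _).
  assert (Hconst : gauss_primitive 0 ^ 2 + 2 * gauss_polar 0 =
      gauss_primitive x ^ 2 + 2 * gauss_polar x).
  { destruct Hx as [Hx|<-]; [|reflexivity].
    apply (eq_is_derive (V := R_NormedModule)
      (fun y => gauss_primitive y ^ 2 + 2 * gauss_polar y) 0 x); [|exact Hx].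
    intros t _. evar_last.
    - apply (is_derive_plus (V := R_NormedModule) (fun y => gauss_primitive y ^ 2)
        (fun y => 2 * gauss_polar y)).
      + apply (is_derive_pow gauss_primitive 2), is_derive_gauss_primitive.
      + apply is_derive_scal, is_derive_gauss_polar.
    - unfold plus, zero; simpl. ring. }
  rewrite gauss_polar_0, Hzero in Hconst. lra.
Qed.

Lemma exp_le_compat (x y : R) : x <= y -> exp x <= exp y.
Proof. intros [H| ->]; [apply Rlt_le, exp_increasing, H|apply Rle_refl]. Qed.

Lemma abs_gauss_polar_le (x : R) : Rabs (gauss_polar x) <= exp (- x ^ 2 / 2) * PI.
Proof.
  apply abs_RInt_le_PI.
  - apply continuous_locally_integrable, continuous_gauss_polar_integrand.
  - intros t. pose proof (cauchy_weight_range t). unfold gauss_polar_integrand.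
    rewrite Rabs_mult, (Rabs_pos_eq (cauchy_weight t)), Rabs_pos_eq
      by (try apply Rlt_le, exp_pos; lra).
    apply Rmult_le_compat_r; [lra|].
    apply exp_le_compat. pose proof (Rmult_le_pos _ _ (pow2_ge_0 x) (pow2_ge_0 t)). lra.
Qed.

Lemma filterlim_gauss_polar : filterlim gauss_polar (Rbar_locally p_infty) (locally 0).
Proof.
  apply (filterlim_locally_Rabs (Rbar_locally p_infty)). intros eps Heps.
  pose proof PI_RGT_0 as Hpi.
  assert (He : 0 < eps / PI) by (apply Rdiv_lt_0_compat; assumption).
  destruct (proj1 (filterlim_locally_Rabs _ _ _) is_lim_exp_m (eps / PI) He) as [M HM].
  exists (Rmax 2 (- M)). intros x Hx.
  assert (Hx2 : 2 < x) by (eapply Rle_lt_trans; [apply Rmax_l|exact Hx]).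
  assert (HxM : - M < x) by (eapply Rle_lt_trans; [apply Rmax_r|exact Hx]).
  specialize (HM (- x ^ 2 / 2) ltac:(nra)).
  rewrite Rminus_0_r, (Rabs_pos_eq (exp _)) in HM by apply Rlt_le, exp_pos.
  rewrite Rminus_0_r. eapply Rle_lt_trans; [apply abs_gauss_polar_le|].
  replace eps with (eps / PI * PI) by (field; lra). apply Rmult_lt_compat_r; assumption.
Qed.

Lemma filterlim_gauss_primitive_p_infty :
  filterlim gauss_primitive (Rbar_locally p_infty) (locally (sqrt (PI / 2))).
Proof.
  pose proof PI_RGT_0 as Hpi.
  apply (filterlim_ext_loc (fun x => sqrt (PI / 2 - 2 * gauss_polar x))).
  { exists 0. intros x Hx. rewrite <- gauss_primitive_sqr by lra. apply sqrt_pow2.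
    apply RInt_ge_0; [lra|apply locally_integrable_gauss|]. intros t _. apply Rlt_le, exp_pos. }
  replace (sqrt (PI / 2)) with (sqrt (PI / 2 - 2 * 0)) by (f_equal; ring).
  apply (filterlim_continuous _ gauss_polar (fun z => sqrt (PI / 2 - 2 * z)) 0).
  - continuous_by_derive. lra.
  - exact filterlim_gauss_polar.
Qed.

Lemma filterlim_gauss_primitive_m_infty :
  filterlim gauss_primitive (Rbar_locally m_infty) (locally (- sqrt (PI / 2))).
Proof.
  apply (filterlim_ext (fun x => - gauss_primitive (- x))).
  { intros x. rewrite gauss_primitive_opp. ring. }
  apply (filterlim_Ropp (Rbar_locally m_infty) (fun x => gauss_primitive (- x))).
  exact (filterlim_comp _ _ _ Ropp gauss_primitive _ _ _ (filterlim_Rbar_opp m_infty)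
           filterlim_gauss_primitive_p_infty).
Qed.

Lemma filterlim_affine_infty (c mu : R) (b : Rbar) : 0 < c -> ~ is_finite b ->
  filterlim (fun y => c * (y - mu)) (Rbar_locally b) (Rbar_locally b).
Proof.
  intros Hc Hb P HP.
  destruct b as [b| |]; [exfalso; apply Hb; reflexivity| |]; destruct HP as [M HM];
    exists (M / c + mu); intros y Hy; apply HM;
    assert (HMc : c * (M / c) = M) by (field; lra); nra.
Qed.

Lemma improper_RInt_gauss (k b mu : R) : 0 < b ->
  improper_RInt (fun y => k * exp (- b * (y - mu) ^ 2 / 2)) m_infty p_infty = k * sqrt (2 * PI / b).
Proof.
  intros Hb. pose proof PI_RGT_0 as Hpi.
  assert (Hs : 0 < sqrt b) by (apply sqrt_lt_R0, Hb).
  set (Phi := fun y => k / sqrt b * gauss_primitive (sqrt b * (y - mu))).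
  assert (HPhi : forall y, is_derive Phi y (k * exp (- b * (y - mu) ^ 2 / 2))).
  { intros y. unfold Phi. evar_last.
    - apply is_derive_scal, (is_derive_comp gauss_primitive (fun z => sqrt b * (z - mu))).
      + apply is_derive_gauss_primitive.
      + auto_derive; [exact I|reflexivity].
    - unfold scal; simpl; unfold mult; simpl.
      replace (- (sqrt b * (y - mu) * (sqrt b * (y - mu) * 1)) / 2) with
        (- (sqrt b * sqrt b) * ((y - mu) * ((y - mu) * 1)) / 2) by (unfold Rdiv; ring).
      rewrite sqrt_sqrt by lra. field. lra. }
  assert (HD : Derive Phi = fun y => k * exp (- b * (y - mu) ^ 2 / 2)).
  { apply functional_extensionality. intros y. apply is_derive_unique, HPhi. }
  assert (Hlim : forall c s, ~ is_finite c ->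
      filterlim gauss_primitive (Rbar_locally c) (locally s) ->
      filterlim Phi (Rbar_locally c) (locally (k / sqrt b * s))).
  { intros c s Hc Hg. apply (filterlim_Rmult (Rbar_locally c)); [apply filterlim_const|].
    exact (filterlim_comp _ _ _ _ _ _ _ _ (filterlim_affine_infty (sqrt b) mu c Hs Hc) Hg). }
  apply improper_RInt_unique. rewrite <- HD.
  replace (k * sqrt (2 * PI / b))
    with (k / sqrt b * sqrt (PI / 2) - k / sqrt b * - sqrt (PI / 2)).
  - apply is_RInt_gen_Derive.
    + apply filter_forall. intros p y _. eexists. apply HPhi.
    + apply filter_forall. intros p y _. rewrite HD.
      continuous_by_derive. auto.
    + apply Hlim; [discriminate|exact filterlim_gauss_primitive_m_infty].
    + apply Hlim; [discriminate|exact filterlim_gauss_primitive_p_infty].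
  - replace (2 * PI / b) with (PI / 2 * 2 ^ 2 / b) by (field; lra).
    rewrite (sqrt_div_alt (PI / 2 * 2 ^ 2)) by exact Hb.
    rewrite (sqrt_mult (PI / 2)), sqrt_pow2 by lra. field. lra.
Qed.

(** * Local limit theorem for binomial coefficients *)

Definition step_ratio (u : R) : R := (1 + u) / (1 - u) * exp (- 2 * u).

Lemma step_ratio_ge1 (u : R) : 0 <= u < 1 -> 1 <= step_ratio u.
Proof.
  intros Hu.
  set (f := fun v => (1 + v) * exp (- v) - (1 - v) * exp v).
  assert (Hf : forall v, is_derive f v (v * (exp v - exp (- v)))).
  { intros v. unfold f. auto_derive; auto. ring. }
  assert (Hmono : (1 - u) * exp u <= (1 + u) * exp (- u)).
  { destruct (MVT_gen f 0 u (fun v => v * (exp v - exp (- v)))) as [v [Hv E]].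
    - intros v _. apply Hf.
    - intros v _. apply continuity_pt_filterlim.
      apply (ex_derive_continuous (V := R_NormedModule)). eexists. apply Hf.
    - rewrite Rmin_left, Rmax_right in Hv by lra. unfold f in E. rewrite Ropp_0, exp_0 in E.
      pose proof (exp_le_compat (- v) v ltac:(lra)).
      assert (0 <= v * (exp v - exp (- v)) * (u - 0))
        by (apply Rmult_le_pos; [apply Rmult_le_pos|]; lra).
      lra. }
  unfold step_ratio. replace (- 2 * u) with (- u + - u) by ring. rewrite exp_plus.
  pose proof (exp_pos u). apply Rmult_le_reg_r with ((1 - u) * exp u); [nra|].
  replace ((1 + u) / (1 - u) * (exp (- u) * exp (- u)) * ((1 - u) * exp u))
    with ((1 + u) * exp (- u) * (exp (- u) * exp u)) by (field; lra).
  rewrite <- exp_plus, Rplus_opp_l, exp_0. lra.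
Qed.

Lemma step_ratio_le (u : R) : 0 <= u <= 1 / 2 -> step_ratio u <= exp (4 * u ^ 2).
Proof.
  intros Hu. unfold step_ratio.
  apply Rle_trans with (exp (2 * u / (1 - u)) * exp (- 2 * u)).
  - apply Rmult_le_compat_r; [apply Rlt_le, exp_pos|].
    replace ((1 + u) / (1 - u)) with (1 + 2 * u / (1 - u)) by (field; lra).
    apply exp_ineq1_le.
  - rewrite <- exp_plus. apply exp_le_compat.
    replace (2 * u / (1 - u) + - 2 * u) with (2 * u ^ 2 * / (1 - u)) by (field; lra).
    replace (4 * u ^ 2) with (2 * u ^ 2 * 2) by ring.
    apply Rmult_le_compat_l; [pose proof (pow2_ge_0 u); lra|].
    replace 2 with (/ (1 / 2)) by field. apply Rinv_le_contravar; lra.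
Qed.

(* The sum of [n] spins of which [k] are [+1]. *)
Definition spin_sum (n k : nat) : R := 2 * INR k - INR n.

(* The correction [n + 1] (instead of [n]) makes the quotient of consecutive
   values exactly a [step_ratio]: the normalised coefficients are unimodal. *)
Definition normalised_binom (n k : nat) : R :=
  Binomial.C n k * exp (spin_sum n k ^ 2 / (2 * (INR n + 1))).

Definition centre (n : nat) : nat := Nat.div2 (S n).

Definition peak (n : nat) : R := normalised_binom n (centre n).

Lemma binom_pos (n k : nat) : 0 < Binomial.C n k.
Proof.
  unfold Binomial.C. apply Rdiv_lt_0_compat; [|apply Rmult_lt_0_compat]; apply INR_fact_lt_0.
Qed.

Lemma normalised_binom_pos (n k : nat) : 0 < normalised_binom n k.
Proof. apply Rmult_lt_0_compat; [apply binom_pos|apply exp_pos]. Qed.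

Lemma peak_pos (n : nat) : 0 < peak n.
Proof. apply normalised_binom_pos. Qed.

Lemma centre_spec (n : nat) : (n <= 2 * centre n <= S n)%nat.
Proof.
  unfold centre. pose proof (Nat.div2_odd (S n)).
  destruct (Nat.odd (S n)); simpl Nat.b2n in *; lia.
Qed.

Lemma spin_sum_S (n k : nat) : spin_sum n (S k) = spin_sum n k + 2.
Proof. unfold spin_sum. rewrite S_INR. ring. Qed.

Lemma spin_sum_reflect (n k : nat) : (k <= n)%nat -> spin_sum n (n - k) = - spin_sum n k.
Proof. intros Hk. unfold spin_sum. rewrite minus_INR by exact Hk. ring. Qed.

Lemma normalised_binom_reflect (n k : nat) : (k <= n)%nat ->
  normalised_binom n (n - k) = normalised_binom n k.
Proof.
  intros Hk. unfold normalised_binom.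
  rewrite <- pascal_step1, spin_sum_reflect by exact Hk. do 3 f_equal. ring.
Qed.

Lemma normalised_binom_step (n k : nat) : (k < n)%nat ->
  normalised_binom n k = normalised_binom n (S k) * step_ratio ((spin_sum n k + 1) / (INR n + 1)).
Proof.
  intros Hk. unfold normalised_binom. rewrite pascal_step3 by exact Hk.
  pose proof (pos_INR n). pose proof (pos_INR k). pose proof (lt_INR _ _ Hk).
  set (u := (spin_sum n k + 1) / (INR n + 1)).
  assert (Hratio : step_ratio u = INR (S k) / INR (n - k) * exp (- 2 * u)).
  { unfold step_ratio. f_equal. unfold u, spin_sum. rewrite minus_INR, S_INR by lia. field. lra. }
  replace (spin_sum n k ^ 2 / (2 * (INR n + 1)))
    with (spin_sum n (S k) ^ 2 / (2 * (INR n + 1)) + - 2 * u)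
    by (unfold u; rewrite spin_sum_S; field; lra).
  rewrite Hratio, exp_plus, minus_INR, S_INR by lia. field. lra.
Qed.

Lemma spin_sum_upper_half (n j : nat) : 2 * INR j <= spin_sum n (centre n + j).
Proof.
  destruct (centre_spec n) as [Hc _]. apply le_INR in Hc. rewrite mult_INR in Hc.
  simpl (INR 2) in Hc. unfold spin_sum. rewrite plus_INR. lra.
Qed.

Lemma reflect_to_upper_half (n k : nat) : (k <= n)%nat ->
  exists j, (centre n + j <= n)%nat /\
    normalised_binom n k = normalised_binom n (centre n + j) /\
    Rabs (spin_sum n k) = spin_sum n (centre n + j).
Proof.
  assert (Hnonneg : forall j, Rabs (spin_sum n (centre n + j)) = spin_sum n (centre n + j)).
  { intros j. apply Rabs_pos_eq. pose proof (spin_sum_upper_half n j).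
    pose proof (pos_INR j). lra. }
  intros Hk. destruct (le_lt_dec (centre n) k) as [Hc|Hc].
  - exists (k - centre n)%nat. rewrite <- Hnonneg.
    replace (centre n + (k - centre n))%nat with k by lia. auto.
  - pose proof (centre_spec n). exists (n - k - centre n)%nat. rewrite <- Hnonneg.
    replace (centre n + (n - k - centre n))%nat with (n - k)%nat by lia.
    rewrite normalised_binom_reflect, spin_sum_reflect, Rabs_Ropp by exact Hk.
    repeat split. lia.
Qed.

Lemma upper_half_step_range (n j : nat) : (centre n + j < n)%nat ->
  0 <= (spin_sum n (centre n + j) + 1) / (INR n + 1) < 1 /\
  (spin_sum n (centre n + j) + 1) / (INR n + 1) <= spin_sum n (centre n + S j) / (INR n + 1).
Proof.
  intros Hj. pose proof (spin_sum_upper_half n j). pose proof (pos_INR j). pose proof (pos_INR n).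
  assert (Hinv : 0 < / (INR n + 1)) by (apply Rinv_0_lt_compat; lra).
  assert (Hlt : spin_sum n (centre n + j) < INR n) by (unfold spin_sum; apply lt_INR in Hj; lra).
  rewrite Nat.add_succ_r, spin_sum_S. split; [split|].
  - apply Rdiv_le_0_compat; lra.
  - apply Rmult_lt_reg_r with (INR n + 1); [lra|]. unfold Rdiv.
    rewrite Rmult_assoc, Rinv_l; lra.
  - apply Rmult_le_compat_r; lra.
Qed.

Lemma normalised_binom_le_peak (n k : nat) : (k <= n)%nat -> normalised_binom n k <= peak n.
Proof.
  intros Hk. destruct (reflect_to_upper_half n k Hk) as [j [Hj [-> _]]]. clear k Hk.
  induction j as [|j IH].
  - rewrite Nat.add_0_r. apply Rle_refl.
  - eapply Rle_trans; [|apply IH; lia].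
    rewrite (normalised_binom_step n (centre n + j)) by lia.
    destruct (upper_half_step_range n j ltac:(lia)) as [Hu _].
    pose proof (step_ratio_ge1 _ Hu). rewrite Nat.add_succ_r.
    pose proof (normalised_binom_pos n (S (centre n + j))). nra.
Qed.

Lemma peak_le_upper_half (n j : nat) (u : R) : (centre n + j <= n)%nat ->
  spin_sum n (centre n + j) / (INR n + 1) <= u <= 1 / 2 ->
  peak n <= normalised_binom n (centre n + j) * exp (INR j * (4 * u ^ 2)).
Proof.
  induction j as [|j IH]; intros Hj Hu.
  - rewrite Nat.add_0_r, Rmult_0_l, exp_0, Rmult_1_r. apply Rle_refl.
  - destruct (upper_half_step_range n j ltac:(lia)) as [Hstep Hnext].
    set (w := (spin_sum n (centre n + j) + 1) / (INR n + 1)) in *.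
    assert (Hinv : 0 < / (INR n + 1)) by (apply Rinv_0_lt_compat; pose proof (pos_INR n); lra).
    assert (Hw : spin_sum n (centre n + j) / (INR n + 1) <= w)
      by (apply Rmult_le_compat_r; lra).
    eapply Rle_trans; [apply IH; [lia|lra]|].
    rewrite normalised_binom_step by lia. fold w. rewrite <- Nat.add_succ_r.
    rewrite S_INR, Rmult_plus_distr_r, Rmult_1_l, Rplus_comm, exp_plus, !Rmult_assoc.
    apply Rmult_le_compat_l; [apply Rlt_le, normalised_binom_pos|].
    apply Rmult_le_compat_r; [apply Rlt_le, exp_pos|].
    eapply Rle_trans; [apply step_ratio_le; lra|]. apply exp_le_compat.
    apply Rmult_le_compat_l; [lra|]. apply pow_incr; lra.
Qed.

Lemma peak_le_normalised_binom (n k : nat) : (k <= n)%nat ->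
  Rabs (spin_sum n k) / (INR n + 1) <= 1 / 2 ->
  peak n <= normalised_binom n k * exp (2 * Rabs (spin_sum n k) ^ 3 / (INR n + 1) ^ 2).
Proof.
  intros Hk Hu. destruct (reflect_to_upper_half n k Hk) as [j [Hj [-> Em]]]. rewrite Em in *.
  pose proof (spin_sum_upper_half n j) as Hsum. pose proof (pos_INR n).
  eapply Rle_trans; [apply (peak_le_upper_half n j _ Hj (conj (Rle_refl _) Hu))|].
  apply Rmult_le_compat_l; [apply Rlt_le, normalised_binom_pos|]. apply exp_le_compat.
  set (m := spin_sum n (centre n + j)) in *.
  replace (2 * m ^ 3 / (INR n + 1) ^ 2) with (m / 2 * (4 * (m / (INR n + 1)) ^ 2)) by (field; lra).
  apply Rmult_le_compat_r; [pose proof (pow2_ge_0 (m / (INR n + 1))); lra|lra].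
Qed.

Definition spin_lattice (n : nat) : lattice := Lattice (- sqrt (INR n)) (2 / sqrt (INR n)) n.

Lemma sqrt_INR_pos (n : nat) : (0 < n)%nat -> 0 < sqrt (INR n).
Proof. intros Hn. apply sqrt_lt_R0, lt_0_INR, Hn. Qed.

Lemma spin_lattice_node (n k : nat) : (0 < n)%nat ->
  node (spin_lattice n) k = spin_sum n k / sqrt (INR n).
Proof.
  intros Hn. pose proof (sqrt_INR_pos n Hn). unfold node, spin_sum; simpl.
  rewrite <- (sqrt_sqrt (INR n)) at 3 by apply pos_INR. field. lra.
Qed.

Lemma filterlim_sqrt_INR : filterlim (fun n => sqrt (INR n)) eventually (Rbar_locally p_infty).
Proof. exact (filterlim_comp _ _ _ INR sqrt _ _ _ is_lim_seq_INR filterlim_sqrt_p). Qed.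

Lemma filterlim_spin_mesh : filterlim (fun n => mesh (spin_lattice n)) eventually (locally 0).
Proof.
  rewrite <- (Rmult_0_r 2). apply (filterlim_Rmult eventually); [apply filterlim_const|].
  apply (filterlim_comp _ _ _ _ Rinv _ _ _ filterlim_sqrt_INR).
  apply (filterlim_Rbar_inv p_infty). discriminate.
Qed.

Lemma spin_mesh_pos (n : nat) : (0 < n)%nat -> 0 < mesh (spin_lattice n).
Proof. intros Hn. apply Rdiv_lt_0_compat; [lra|exact (sqrt_INR_pos n Hn)]. Qed.

Lemma spin_lattice_refines : refines eventually spin_lattice.
Proof.
  assert (Hpos : eventually (fun n => (0 < n)%nat)) by (exists 1%nat; auto).
  split; [|split].
  - exact (filterlim_comp _ _ _ _ Ropp _ _ _ filterlim_sqrt_INR (filterlim_Rbar_opp p_infty)).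
  - apply (filterlim_ge_p_infty (fun n => sqrt (INR n))); [|exact filterlim_sqrt_INR].
    revert Hpos. apply filter_imp. intros n Hn. pose proof (sqrt_INR_pos n Hn) as Hs.
    rewrite spin_lattice_node by exact Hn. apply Rmult_le_reg_r with (sqrt (INR n)); [exact Hs|].
    unfold Rdiv. rewrite Rmult_assoc, Rinv_l, sqrt_sqrt by (try apply pos_INR; lra).
    unfold spin_sum; simpl steps. rewrite S_INR. lra.
  - intros P HP. unfold filtermap.
    generalize (filter_and _ _ Hpos (filterlim_spin_mesh _ HP)). apply filter_imp.
    intros n [Hn HPn]. apply HPn, spin_mesh_pos, Hn.
Qed.

(* Only the values on the lattice matter; off the lattice we take the limit. *)
Definition binom_profile (n : nat) (x : R) : R :=
  match excluded_middle_informative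
          (exists k, (k <= n)%nat /\ node (spin_lattice n) k = x) with
  | left H => Binomial.C n (proj1_sig (constructive_indefinite_description _ H)) / peak n
  | right _ => exp (- x ^ 2 / 2)
  end.

Lemma spin_lattice_node_inj (n k l : nat) : (0 < n)%nat ->
  node (spin_lattice n) k = node (spin_lattice n) l -> k = l.
Proof.
  intros Hn H. pose proof (spin_mesh_pos n Hn) as Hm. apply INR_eq.
  unfold node in H. apply Rmult_eq_reg_r with (mesh (spin_lattice n)); lra.
Qed.

Lemma binom_profile_node (n k : nat) : (0 < n)%nat -> (k <= n)%nat ->
  binom_profile n (node (spin_lattice n) k) = Binomial.C n k / peak n.
Proof.
  intros Hn Hk. unfold binom_profile.
  destruct (excluded_middle_informative _) as [H|H].
  - destruct (constructive_indefinite_description _ H) as [l [Hl E]]. simpl.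
    apply spin_lattice_node_inj in E; [subst l; reflexivity|exact Hn].
  - exfalso. apply H. exists k. auto.
Qed.

Lemma binom_profile_cases (n : nat) (x : R) : (0 < n)%nat ->
  (exists k, (k <= n)%nat /\ x = spin_sum n k / sqrt (INR n) /\
     binom_profile n x = Binomial.C n k / peak n) \/
  binom_profile n x = exp (- x ^ 2 / 2).
Proof.
  intros Hn.
  destruct (classic (exists k, (k <= n)%nat /\ node (spin_lattice n) k = x)) as [[k [Hk <-]]|Hoff].
  - left. exists k. rewrite binom_profile_node, spin_lattice_node by assumption. auto.
  - right. unfold binom_profile. destruct (excluded_middle_informative _); tauto.
Qed.

Definition shrink (n : nat) : R := INR n / (INR n + 1).

Lemma shrink_range (n : nat) : 0 <= shrink n <= 1.
Proof.
  pose proof (pos_INR n). unfold shrink. split; [apply Rdiv_le_0_compat; lra|].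
  apply Rmult_le_reg_r with (INR n + 1); [lra|]. unfold Rdiv. rewrite Rmult_assoc, Rinv_l; lra.
Qed.

Lemma filterlim_shrink : filterlim shrink eventually (locally 1).
Proof.
  apply (filterlim_ext (fun n => 1 + - / (INR n + 1))).
  { intros n. unfold shrink. pose proof (pos_INR n). field. lra. }
  replace (locally 1) with (locally (1 + - 0)) by (f_equal; ring).
  apply (filterlim_Rplus eventually); [apply filterlim_const|].
  apply (filterlim_Ropp eventually).
  apply (filterlim_comp _ _ _ (fun n => INR n + 1) Rinv _ (Rbar_locally p_infty)).
  - apply (filterlim_ge_p_infty INR); [|exact is_lim_seq_INR].
    apply filter_forall. intros n. lra.
  - apply (filterlim_Rbar_inv p_infty). discriminate.
Qed.

Lemma binom_eq_normalised (n k : nat) (x : R) : (0 < n)%nat -> x = spin_sum n k / sqrt (INR n) ->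
  Binomial.C n k = normalised_binom n k * exp (- x ^ 2 / 2 * shrink n).
Proof.
  intros Hn ->. pose proof (lt_0_INR n Hn).
  replace ((spin_sum n k / sqrt (INR n)) ^ 2) with (spin_sum n k ^ 2 / INR n)
    by (unfold Rdiv; rewrite Rpow_mult_distr, pow_inv, pow2_sqrt by lra; reflexivity).
  unfold normalised_binom. rewrite Rmult_assoc, <- exp_plus.
  replace (spin_sum n k ^ 2 / (2 * (INR n + 1)) +
      - (spin_sum n k ^ 2 / INR n) / 2 * shrink n) with 0
    by (unfold shrink; field; lra).
  rewrite exp_0. ring.
Qed.

Lemma binom_profile_upper (n : nat) (x : R) : (0 < n)%nat ->
  0 < binom_profile n x <= exp (- x ^ 2 / 2 * shrink n).
Proof.
  intros Hn. destruct (binom_profile_cases n x Hn) as [[k [Hk [Ex ->]]]| ->].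
  - pose proof (peak_pos n) as Hp. split.
    + apply Rdiv_lt_0_compat; [apply binom_pos|exact Hp].
    + rewrite (binom_eq_normalised n k x Hn Ex).
      pose proof (normalised_binom_le_peak n k Hk). pose proof (exp_pos (- x ^ 2 / 2 * shrink n)).
      apply Rmult_le_reg_r with (peak n); [exact Hp|]. unfold Rdiv at 1.
      rewrite (Rmult_assoc _ (/ peak n)), Rinv_l by lra. nra.
  - pose proof (shrink_range n). pose proof (pow2_ge_0 x).
    split; [apply exp_pos|apply exp_le_compat; nra].
Qed.

Lemma binom_profile_lower (n : nat) (x : R) : (0 < n)%nat -> 2 * Rabs x <= sqrt (INR n) ->
  exp (- x ^ 2 / 2 - Rabs x ^ 3 * mesh (spin_lattice n)) <= binom_profile n x.
Proof.
  intros Hn Hx. pose proof (sqrt_INR_pos n Hn) as Hs. pose proof (lt_0_INR n Hn) as Hn0.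
  pose proof (shrink_range n). pose proof (pow2_ge_0 x). pose proof (Rabs_pos x) as Habs.
  destruct (binom_profile_cases n x Hn) as [[k [Hk [Ex ->]]]| ->].
  2:{ apply exp_le_compat. pose proof (spin_mesh_pos n Hn). pose proof (pow_le _ 3 Habs). nra. }
  assert (Hss : sqrt (INR n) ^ 2 = INR n) by (apply pow2_sqrt; lra).
  set (s := sqrt (INR n)) in *. set (y := Rabs x) in *.
  assert (Hsum : Rabs (spin_sum n k) = y * s).
  { unfold y. rewrite <- (Rabs_pos_eq s) by lra. rewrite <- Rabs_mult, Ex. f_equal. field. lra. }
  assert (Hsmall : Rabs (spin_sum n k) / (INR n + 1) <= 1 / 2).
  { rewrite Hsum. apply Rmult_le_reg_r with (INR n + 1); [lra|]. unfold Rdiv at 1.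
    rewrite Rmult_assoc, Rinv_l by lra. nra. }
  assert (Herr : 2 * Rabs (spin_sum n k) ^ 3 / (INR n + 1) ^ 2 <= y ^ 3 * mesh (spin_lattice n)).
  { replace (y ^ 3 * mesh (spin_lattice n)) with (2 * (y * s) ^ 3 / (s ^ 2) ^ 2)
      by (simpl; fold s; field; lra).
    rewrite Hsum, Hss. apply Rmult_le_compat_l.
    - apply Rmult_le_pos; [lra|apply pow_le, Rmult_le_pos; lra].
    - apply Rinv_le_contravar; [apply pow_lt; lra|apply pow_incr; lra]. }
  pose proof (peak_le_normalised_binom n k Hk Hsmall) as Hpeak.
  pose proof (peak_pos n) as Hp.
  rewrite (binom_eq_normalised n k x Hn Ex).
  apply Rmult_le_reg_r with (peak n); [exact Hp|]. unfold Rdiv at 2.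
  rewrite (Rmult_assoc _ (/ peak n)), Rinv_l, Rmult_1_r by lra.
  eapply Rle_trans; [apply Rmult_le_compat_l; [apply Rlt_le, exp_pos|exact Hpeak]|].
  rewrite (Rmult_comm _ (normalised_binom n k * _)), Rmult_assoc, <- exp_plus.
  apply Rmult_le_compat_l; [apply Rlt_le, normalised_binom_pos|]. apply exp_le_compat. nra.
Qed.

Theorem binom_profile_cv :
  continuous_convergence eventually binom_profile (fun x => exp (- x ^ 2 / 2)).
Proof.
  intros y. set (F := filter_prod eventually (locally y)).
  assert (Hn : filterlim fst F eventually) by exact filterlim_fst.
  assert (Hx : forall h : R -> R, continuous h y ->
      filterlim (fun p => h (snd p)) F (locally (h y))).
  { intros h Hh. exact (filterlim_comp _ _ _ snd h F _ _ filterlim_snd Hh). }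
  assert (Hexp : forall (u : nat * R -> R) (l : R), filterlim u F (locally l) -> l = - y ^ 2 / 2 ->
      filterlim (fun p => exp (u p)) F (locally (exp (- y ^ 2 / 2)))).
  { intros u l Hu <-. apply (filterlim_continuous F u exp); [|exact Hu].
    continuous_by_derive. auto. }
  assert (Hsqr : filterlim (fun p => - snd p ^ 2 / 2) F (locally (- y ^ 2 / 2))).
  { apply (Hx (fun x => - x ^ 2 / 2)). continuous_by_derive. auto. }
  apply (filterlim_le_le
    (fun p => exp (- snd p ^ 2 / 2 + - Rabs (snd p) ^ 3 * mesh (spin_lattice (fst p))))
    (fun p => binom_profile (fst p) (snd p))
    (fun p => exp (- snd p ^ 2 / 2 * shrink (fst p))) (exp (- y ^ 2 / 2))).
  - apply Filter_prod with (fun n => (0 < n)%nat /\ 2 * (Rabs y + 1) < sqrt (INR n))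
      (fun x => Rabs (x - y) < 1).
    + apply (filter_and (F := eventually)); [exists 1%nat; auto|].
      apply (filterlim_sqrt_INR (fun s => 2 * (Rabs y + 1) < s)). exists (2 * (Rabs y + 1)). auto.
    + exists (mkposreal 1 Rlt_0_1). auto.
    + intros n x [Hpos Hs] Hxy. cbn [fst snd]. split; [|apply binom_profile_upper, Hpos].
      rewrite Ropp_mult_distr_l_reverse. apply binom_profile_lower; [exact Hpos|].
      pose proof (Rabs_triang_inv x y). lra.
  - apply (Hexp _ (- y ^ 2 / 2 + - Rabs y ^ 3 * 0)); [|ring].
    apply (filterlim_Rplus F); [exact Hsqr|]. apply (filterlim_Rmult F).
    + apply (Hx (fun x => - Rabs x ^ 3)).
      apply (filterlim_continuous (locally y) Rabs (fun z => - z ^ 3));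
        [continuous_by_derive; auto|apply (continuous_Rabs y)].
    + exact (filterlim_comp _ _ _ fst _ F _ _ Hn filterlim_spin_mesh).
  - apply (Hexp _ (- y ^ 2 / 2 * 1)); [|ring]. apply (filterlim_Rmult F); [exact Hsqr|].
    exact (filterlim_comp _ _ _ fst _ F _ _ Hn filterlim_shrink).
Qed.

(** * Bivariate Gaussian integrals *)

Definition gauss2 (A B c x y : R) : R := exp (- (A * x ^ 2 + B * y ^ 2 - 2 * c * x * y) / 2).

Lemma filterlim_gauss2 {T : Type} (F : (T -> Prop) -> Prop) {FF : Filter F}
    (A B c u v : T -> R) (A0 B0 c0 x y : R) :
  filterlim A F (locally A0) -> filterlim B F (locally B0) -> filterlim c F (locally c0) ->
  filterlim u F (locally x) -> filterlim v F (locally y) ->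
  filterlim (fun t => gauss2 (A t) (B t) (c t) (u t) (v t)) F (locally (gauss2 A0 B0 c0 x y)).
Proof.
  intros HA HB Hc Hu Hv.
  assert (Hsqr : forall z, continuous (fun w => w ^ 2) z).
  { intros z. continuous_by_derive. auto. }
  apply (filterlim_continuous F _ (fun z => exp (- z / 2))).
  { continuous_by_derive. auto. }
  apply (filterlim_Rplus F); [apply (filterlim_Rplus F)|].
  - apply (filterlim_Rmult F); [exact HA|]. exact (filterlim_continuous F u _ x (Hsqr x) Hu).
  - apply (filterlim_Rmult F); [exact HB|]. exact (filterlim_continuous F v _ y (Hsqr y) Hv).
  - apply (filterlim_Ropp F). repeat apply (filterlim_Rmult F); auto. apply filterlim_const.
Qed.

Lemma jointly_continuous_gauss2 (A B c : R) : jointly_continuous (gauss2 A B c).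
Proof.
  intros x y. apply (filterlim_gauss2 (filter_prod (locally x) (locally y))
    (fun _ => A) (fun _ => B) (fun _ => c) fst snd); try apply filterlim_const.
  - exact filterlim_fst.
  - exact filterlim_snd.
Qed.

Lemma gauss2_tilt (s t A B c x y : R) :
  exp (- x ^ 2 / 2 * s) * exp (- y ^ 2 / 2 * t) * gauss2 A B c x y = gauss2 (s + A) (t + B) c x y.
Proof. unfold gauss2. rewrite <- !exp_plus. f_equal. field. Qed.

Definition coercive (l A B c : R) : Prop :=
  forall x y, l * (x ^ 2 + y ^ 2) <= A * x ^ 2 + B * y ^ 2 - 2 * c * x * y.

(* det / trace bounds the smallest eigenvalue from below *)
Lemma pos_def_coercive (A B c : R) : 0 < A -> 0 < B -> c ^ 2 < A * B ->
  coercive ((A * B - c ^ 2) / (A + B)) A B c.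
Proof.
  intros HA HB Hc x y. set (l := (A * B - c ^ 2) / (A + B)).
  assert (El : l * (A + B) = A * B - c ^ 2) by (unfold l; field; lra).
  assert (HlA : l < A) by (apply Rmult_lt_reg_r with (A + B); [lra|]; rewrite El; nra).
  assert (Hshift : 0 <= (A - l) * ((A - l) * x ^ 2 - 2 * c * x * y + (B - l) * y ^ 2)).
  { replace ((A - l) * ((A - l) * x ^ 2 - 2 * c * x * y + (B - l) * y ^ 2)) with
      (((A - l) * x - c * y) ^ 2 + (A * B - l * (A + B) + l ^ 2 - c ^ 2) * y ^ 2) by ring.
    rewrite El. replace (A * B - (A * B - c ^ 2) + l ^ 2 - c ^ 2) with (l ^ 2) by ring.
    rewrite <- Rpow_mult_distr. apply Rplus_le_le_0_compat; apply pow2_ge_0. }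
  apply Rmult_le_reg_l with (A - l); lra.
Qed.

Lemma coercive_perturbation (l e A B c A' B' c' : R) : coercive l A B c ->
  Rabs (A' - A) < e -> Rabs (B' - B) < e -> Rabs (c' - c) < e -> coercive (l - 2 * e) A' B' c'.
Proof.
  intros Hcoer HA HB Hc x y. specialize (Hcoer x y).
  apply Rabs_lt_between in HA. apply Rabs_lt_between in HB. apply Rabs_lt_between in Hc.
  pose proof (pow2_ge_0 x). pose proof (pow2_ge_0 y).
  assert (Hxy : - (x ^ 2 + y ^ 2) <= 2 * x * y <= x ^ 2 + y ^ 2)
    by (pose proof (pow2_ge_0 (x + y)); pose proof (pow2_ge_0 (x - y)); lra).
  assert (Hcross : (c' - c) * (2 * x * y) <= e * (x ^ 2 + y ^ 2)) by nra.
  nra.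
Qed.

Lemma exp_le_cauchy_weight (e x : R) : 0 < e -> exp (- e * x ^ 2) <= (1 + / e) * cauchy_weight x.
Proof.
  intros He. pose proof (pow2_ge_0 x) as Hx. pose proof (Rinv_0_lt_compat e He) as Hinv.
  assert (Hex : 0 <= e * x ^ 2) by (apply Rmult_le_pos; lra).
  assert (Hmul : 1 + x ^ 2 <= (1 + / e) * (1 + e * x ^ 2)).
  { replace ((1 + / e) * (1 + e * x ^ 2)) with (1 + / e + e * x ^ 2 + x ^ 2) by (field; lra). lra. }
  apply Rle_trans with (/ (1 + e * x ^ 2)).
  - replace (- e * x ^ 2) with (- (e * x ^ 2)) by ring. rewrite exp_Ropp.
    apply Rinv_le_contravar; [lra|apply exp_ineq1_le].
  - unfold cauchy_weight. apply Rmult_le_reg_r with ((1 + e * x ^ 2) * (1 + x ^ 2)).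
    + apply Rmult_lt_0_compat; lra.
    + eapply Rle_trans; [|eapply Rle_trans; [exact Hmul|]]; right; field; lra.
Qed.

Lemma gauss2_dominated (l A B c : R) : 0 < l -> coercive l A B c ->
  cauchy_dominated2 ((1 + / (l / 2)) ^ 2) (gauss2 A B c).
Proof.
  intros Hl Hcoer x y. unfold gauss2. rewrite Rabs_pos_eq by apply Rlt_le, exp_pos.
  apply Rle_trans with (exp (- (l / 2) * x ^ 2) * exp (- (l / 2) * y ^ 2)).
  - rewrite <- exp_plus. apply exp_le_compat. specialize (Hcoer x y). lra.
  - replace ((1 + / (l / 2)) ^ 2 * cauchy_weight x * cauchy_weight y)
      with ((1 + / (l / 2)) * cauchy_weight x * ((1 + / (l / 2)) * cauchy_weight y)) by ring.
    apply Rmult_le_compat; try apply Rlt_le, exp_pos; apply exp_le_cauchy_weight; lra.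
Qed.

Lemma eventually_gauss2_dominated {T : Type} (F : (T -> Prop) -> Prop) {FF : Filter F}
    (A B c : T -> R) (A0 B0 c0 : R) :
  0 < A0 -> 0 < B0 -> c0 ^ 2 < A0 * B0 ->
  filterlim A F (locally A0) -> filterlim B F (locally B0) -> filterlim c F (locally c0) ->
  exists K, F (fun t => cauchy_dominated2 K (gauss2 (A t) (B t) (c t))).
Proof.
  intros HA0 HB0 Hc0 HA HB Hc. pose proof (pos_def_coercive A0 B0 c0 HA0 HB0 Hc0) as Hcoer.
  set (l := (A0 * B0 - c0 ^ 2) / (A0 + B0)) in *.
  assert (Hl : 0 < l) by (apply Rdiv_lt_0_compat; lra).
  assert (Hl4 : 0 < l / 4) by lra.
  exists ((1 + / ((l - 2 * (l / 4)) / 2)) ^ 2).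
  generalize (filter_and _ _ (proj1 (filterlim_locally_Rabs F _ _) HA _ Hl4)
    (filter_and _ _ (proj1 (filterlim_locally_Rabs F _ _) HB _ Hl4)
      (proj1 (filterlim_locally_Rabs F _ _) Hc _ Hl4))).
  apply filter_imp. intros t [HAt [HBt Hct]]. apply gauss2_dominated; [lra|].
  apply coercive_perturbation with (1 := Hcoer); assumption.
Qed.

Lemma gauss2_mass (A B c : R) : 0 < B -> c ^ 2 < A * B ->
  improper_RInt2 (gauss2 A B c) p_infty p_infty = 2 * PI / sqrt (A * B - c ^ 2).
Proof.
  intros HB Hc. pose proof PI_RGT_0 as Hpi.
  set (D := A * B - c ^ 2). assert (HD : 0 < D) by (unfold D; lra).
  assert (Hrow : forall x, improper_RInt (gauss2 A B c x) m_infty p_infty =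
      sqrt (2 * PI / B) * exp (- (D / B) * (x - 0) ^ 2 / 2)).
  { intros x. rewrite Rmult_comm, <- (improper_RInt_gauss _ B (c * x / B)) by exact HB. f_equal.
    apply functional_extensionality. intros y. unfold gauss2. rewrite <- exp_plus.
    f_equal. unfold D. field. lra. }
  unfold improper_RInt2.
  replace (fun x => improper_RInt (gauss2 A B c x) m_infty p_infty) with
    (fun x => sqrt (2 * PI / B) * exp (- (D / B) * (x - 0) ^ 2 / 2))
    by (apply functional_extensionality; auto).
  rewrite improper_RInt_gauss by (apply Rdiv_lt_0_compat; lra).
  rewrite <- sqrt_mult_alt by (apply Rlt_le, Rdiv_lt_0_compat; lra).
  replace (2 * PI / B * (2 * PI / (D / B))) with ((2 * PI) ^ 2 / D) by (field; lra).
  rewrite sqrt_div_alt, sqrt_pow2 by lra. reflexivity.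
Qed.

Lemma gauss2_density_eq (A B c x y : R) : let D := A * B - c ^ 2 in 0 < D ->
  gauss2_density (B / D) (c / D) (A / D) x y = sqrt D / (2 * PI) * gauss2 A B c x y.
Proof.
  intros D HD. pose proof PI_RGT_0. pose proof (sqrt_lt_R0 D HD). unfold gauss2_density, gauss2.
  assert (Edet : B / D * (A / D) - (c / D) ^ 2 = / D).
  { transitivity ((A * B - c ^ 2) / (D * D)); [field; lra|]. fold D. field. lra. }
  rewrite Edet, sqrt_inv.
  replace (- (A / D * x ^ 2 - 2 * (c / D) * x * y + B / D * y ^ 2) / (2 * / D)) with
    (- (A * x ^ 2 + B * y ^ 2 - 2 * c * x * y) / 2) by (field; lra).
  field. lra.
Qed.

Lemma Rint_RInt (f : R -> R) (a b : R) : ex_RInt f a b -> Rint f a b = RInt f a b.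
Proof.
  intros Hf. unfold Rint. destruct (excluded_middle_informative _) as [Hint|Hnot].
  - symmetry. apply RInt_Reals.
  - exfalso. apply Hnot. exists (ex_RInt_Reals_0 f a b Hf). exact I.
Qed.

Lemma Rint_box_scal (f : R -> R -> R) (k a b M : R) : jointly_continuous f ->
  Rint (fun x => Rint (fun y => k * f x y) (- M) b) (- M) a =
  k * RInt (fun x => RInt (f x) (- M) b) (- M) a.
Proof.
  intros Hf.
  replace (fun x => Rint (fun y => k * f x y) (- M) b) with (fun x => k * RInt (f x) (- M) b).
  - rewrite Rint_RInt by apply locally_integrable_Rmult_l, jointly_continuous_RInt, Hf.
    apply RInt_Rmult_l, jointly_continuous_RInt, Hf.
  - apply functional_extensionality. intros x.
    rewrite Rint_RInt by apply locally_integrable_Rmult_l, jointly_continuous_row, Hf.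
    symmetry. apply RInt_Rmult_l, jointly_continuous_row, Hf.
Qed.

Theorem is_gauss2_cdf_improper_RInt2 (A B c a b : R) : 0 < A -> 0 < B -> c ^ 2 < A * B ->
  let D := A * B - c ^ 2 in
  is_gauss2_cdf (B / D) (c / D) (A / D) a b
    (improper_RInt2 (gauss2 A B c) a b / improper_RInt2 (gauss2 A B c) p_infty p_infty).
Proof.
  intros HA HB Hc D eps Heps. pose proof PI_RGT_0 as Hpi.
  assert (HD : 0 < D) by (unfold D; lra). pose proof (sqrt_lt_R0 D HD) as HsD.
  destruct (eventually_gauss2_dominated (locally 0) (fun _ => A) (fun _ => B) (fun _ => c) A B c)
    as [K HK]; try apply filterlim_const; try assumption.
  apply locally_singleton in HK.
  pose proof (filterlim_Rmult (Rbar_locally p_infty) (fun _ => sqrt D / (2 * PI)) _ _ _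
    (filterlim_const _)
    (RInt_box_cv (gauss2 A B c) K a b (jointly_continuous_gauss2 A B c) HK)) as Hbox.
  destruct (proj1 (filterlim_locally_Rabs _ _ _) Hbox eps Heps) as [M0 HM0].
  exists (M0 + 1). intros M HM. specialize (HM0 M ltac:(lra)).
  rewrite gauss2_mass by assumption. fold D.
  replace (improper_RInt2 (gauss2 A B c) a b / (2 * PI / sqrt D))
    with (sqrt D / (2 * PI) * improper_RInt2 (gauss2 A B c) a b) by (field; lra).
  rewrite <- Rint_box_scal in HM0 by apply jointly_continuous_gauss2.
  replace (fun x => Rint (fun y => gauss2_density (B / D) (c / D) (A / D) x y) (- M) b)
    with (fun x => Rint (fun y => sqrt D / (2 * PI) * gauss2 A B c x y) (- M) b); [exact HM0|].
  apply functional_extensionality. intros x. f_equal.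
  apply functional_extensionality. intros y. symmetry. apply gauss2_density_eq, HD.
Qed.

(** * The model as a lattice sum *)

Lemma sum_pascal (G : nat -> R) (n : nat) :
  sum_f_R0 (fun k => Binomial.C n k * G (S k)) n + sum_f_R0 (fun k => Binomial.C n k * G k) n =
  sum_f_R0 (fun k => Binomial.C (S n) k * G k) (S n).
Proof.
  destruct n as [|m].
  - simpl. rewrite !C_n_0, C_n_n. ring.
  - rewrite (decomp_sum (fun k => Binomial.C (S m) k * G k)) by lia.
    rewrite (decomp_sum (fun k => Binomial.C (S (S m)) k * G k)) by lia.
    simpl Nat.pred.
    rewrite (tech5 (fun k => Binomial.C (S m) k * G (S k))).
    rewrite (tech5 (fun k => Binomial.C (S (S m)) (S k) * G (S k))).
    rewrite !C_n_0, !C_n_n.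
    rewrite (sum_eq (fun k => Binomial.C (S (S m)) (S k) * G (S k))
      (fun k => Binomial.C (S m) (S k) * G (S k) + Binomial.C (S m) k * G (S k))).
    + rewrite sum_plus. ring.
    + intros i Hi. rewrite <- pascal by lia. ring.
Qed.

Lemma sumR_app (l1 l2 : list R) : sumR (l1 ++ l2) = sumR l1 + sumR l2.
Proof.
  unfold sumR. induction l1 as [|x l1 IH]; simpl; [|rewrite IH]; ring.
Qed.

Lemma sumR_configs (n : nat) (g : R -> R) :
  sumR (map (fun x => g (sumR x)) (configs n)) =
  sum_f_R0 (fun k => Binomial.C n k * g (spin_sum n k)) n.
Proof.
  revert g. induction n as [|n IH]; intros g.
  - simpl. unfold sumR, spin_sum; simpl. rewrite C_n_0, Rmult_0_r, Rminus_0_r. ring.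
  - cbn [configs]. rewrite map_app, sumR_app, !map_map.
    change (sumR (map (fun x => g (1 + sumR x)) (configs n)) +
      sumR (map (fun x => g (-1 + sumR x)) (configs n)) =
      sum_f_R0 (fun k => Binomial.C (S n) k * g (spin_sum (S n) k)) (S n)).
    rewrite (IH (fun s => g (1 + s))), (IH (fun s => g (-1 + s))).
    rewrite <- (sum_pascal (fun k => g (spin_sum (S n) k))).
    f_equal; apply sum_eq; intros k _; do 2 f_equal; unfold spin_sum; rewrite !S_INR; ring.
Qed.

Definition lattice_norm (n : nat) : R := peak n / mesh (spin_lattice n).

Lemma lattice_norm_pos (n : nat) : (0 < n)%nat -> 0 < lattice_norm n.
Proof. intros Hn. apply Rdiv_lt_0_compat; [apply peak_pos|apply spin_mesh_pos, Hn]. Qed.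

Lemma sumR_configs_lattice_sum (n : nat) (b : Rbar) (g : R -> R) : (0 < n)%nat ->
  sumR (map (fun x => g (sumR x / sqrt (INR n)) * indicator_upto b (sumR x / sqrt (INR n)))
         (configs n)) =
  lattice_norm n * lattice_sum (spin_lattice n) b (fun x => binom_profile n x * g x).
Proof.
  intros Hn. pose proof (spin_mesh_pos n Hn). pose proof (peak_pos n).
  rewrite (sumR_configs n (fun s => g (s / sqrt (INR n)) * indicator_upto b (s / sqrt (INR n)))).
  unfold lattice_sum. rewrite <- Rmult_assoc.
  replace (lattice_norm n * mesh (spin_lattice n)) with (peak n)
    by (unfold lattice_norm; field; lra).
  rewrite scal_sum. apply sum_eq. intros k Hk.
  rewrite binom_profile_node, spin_lattice_node by assumption. field. lra.
Qed.

Lemma sum_configs_lattice_sum (n m : nat) (b1 b2 : Rbar) (w : R -> R -> R) :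
  (0 < n)%nat -> (0 < m)%nat ->
  sum_configs n m (fun x y => w (sumR x / sqrt (INR n)) (sumR y / sqrt (INR m)) *
    (indicator_upto b1 (sumR x / sqrt (INR n)) * indicator_upto b2 (sumR y / sqrt (INR m)))) =
  lattice_norm n * lattice_norm m * lattice_sum (spin_lattice n) b1 (fun x =>
    lattice_sum (spin_lattice m) b2 (fun y => binom_profile n x * binom_profile m y * w x y)).
Proof.
  intros Hn Hm.
  set (inner := fun x => lattice_sum (spin_lattice m) b2 (fun y => binom_profile m y * w x y)).
  transitivity (sumR (map (fun x => lattice_norm m * inner (sumR x / sqrt (INR n)) *
    indicator_upto b1 (sumR x / sqrt (INR n))) (configs n))).
  - unfold sum_configs. f_equal. apply map_ext. intros x.
    set (s := sumR x / sqrt (INR n)). set (i := indicator_upto b1 s).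
    rewrite Rmult_assoc, (Rmult_comm (inner s)). unfold inner. rewrite <- lattice_sum_Rmult_l.
    replace (fun y => i * (binom_profile m y * w s y))
      with (fun y => binom_profile m y * (i * w s y))
      by (apply functional_extensionality; intros y; ring).
    rewrite <- sumR_configs_lattice_sum by exact Hm.
    f_equal. apply map_ext. intros y. ring.
  - rewrite (sumR_configs_lattice_sum n b1 (fun x => lattice_norm m * inner x)) by exact Hn.
    rewrite Rmult_assoc. f_equal. rewrite <- lattice_sum_Rmult_l. f_equal.
    apply functional_extensionality. intros x. unfold inner.
    rewrite <- Rmult_assoc, (Rmult_comm (binom_profile n x)), Rmult_assoc, <- lattice_sum_Rmult_l.
    do 2 f_equal. apply functional_extensionality. intros y. ring.
Qed.

Definition ratio (N n : nat) : R := INR n / INR N.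

Definition coupling (Jb : R) (N n m : nat) : R := sqrt (ratio N n * ratio N m) * Jb.

Lemma cw_weight_gauss2 (J1 J2 Jb : R) (N n m : nat) (x y : list R) :
  (0 < N)%nat -> (0 < n)%nat -> (0 < m)%nat ->
  cw_weight N J1 J2 Jb x y =
  gauss2 (- (ratio N n * J1)) (- (ratio N m * J2)) (coupling Jb N n m)
    (sumR x / sqrt (INR n)) (sumR y / sqrt (INR m)).
Proof.
  intros HN Hn Hm. unfold cw_weight, gauss2, coupling. f_equal.
  pose proof (lt_0_INR N HN). pose proof (lt_0_INR n Hn). pose proof (lt_0_INR m Hm).
  pose proof (sqrt_INR_pos n Hn). pose proof (sqrt_INR_pos m Hm).
  assert (Hsqrt : sqrt (ratio N n * ratio N m) = sqrt (INR n) * sqrt (INR m) / INR N).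
  { unfold ratio. replace (INR n / INR N * (INR m / INR N)) with
      (INR n * INR m / (INR N) ^ 2) by (field; lra).
    rewrite sqrt_div_alt, sqrt_pow2, sqrt_mult by (try apply pow_lt; lra). reflexivity. }
  assert (Hsqr : forall s r, 0 < r -> (s / sqrt r) ^ 2 = s ^ 2 / r).
  { intros s r Hr. unfold Rdiv. rewrite Rpow_mult_distr, pow_inv, pow2_sqrt by lra. reflexivity. }
  rewrite Hsqrt, !Hsqr by assumption. unfold ratio. field. lra.
Qed.

Definition cw_profile (J1 J2 Jb : R) (N n m : nat) (x y : R) : R :=
  binom_profile n x * binom_profile m y *
  gauss2 (- (ratio N n * J1)) (- (ratio N m * J2)) (coupling Jb N n m) x y.

Lemma abs_cw_profile_le (J1 J2 Jb : R) (N n m : nat) (x y : R) : (0 < n)%nat -> (0 < m)%nat ->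
  Rabs (cw_profile J1 J2 Jb N n m x y) <=
  Rabs (gauss2 (shrink n + - (ratio N n * J1)) (shrink m + - (ratio N m * J2))
          (coupling Jb N n m) x y).
Proof.
  intros Hn Hm. rewrite <- gauss2_tilt. unfold cw_profile. rewrite !Rabs_mult.
  apply Rmult_le_compat_r; [apply Rabs_pos|].
  destruct (binom_profile_upper n x Hn). destruct (binom_profile_upper m y Hm).
  apply Rmult_le_compat; try apply Rabs_pos; rewrite !Rabs_pos_eq; lra.
Qed.

Definition cw_lattice_sum (J1 J2 Jb : R) (N n m : nat) (b1 b2 : Rbar) : R :=
  lattice_sum (spin_lattice n) b1
    (fun x => lattice_sum (spin_lattice m) b2 (cw_profile J1 J2 Jb N n m x)).

Lemma sum_configs_upto (J1 J2 Jb : R) (N n m : nat) (b1 b2 : Rbar) :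
  (0 < N)%nat -> (0 < n)%nat -> (0 < m)%nat ->
  sum_configs n m (fun x y => cw_weight N J1 J2 Jb x y *
    (indicator_upto b1 (sumR x / sqrt (INR n)) * indicator_upto b2 (sumR y / sqrt (INR m)))) =
  lattice_norm n * lattice_norm m * cw_lattice_sum J1 J2 Jb N n m b1 b2.
Proof.
  intros HN Hn Hm.
  etransitivity; [|apply (sum_configs_lattice_sum n m b1 b2 (gauss2 (- (ratio N n * J1))
    (- (ratio N m * J2)) (coupling Jb N n m)) Hn Hm)].
  f_equal. do 2 (apply functional_extensionality; intros ?).
  rewrite (cw_weight_gauss2 J1 J2 Jb N n m) by assumption. reflexivity.
Qed.

Lemma cw_cdf_lattice_sum (J1 J2 Jb a b : R) (N n m : nat) :
  (0 < N)%nat -> (0 < n)%nat -> (0 < m)%nat ->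
  cw_cdf N n m J1 J2 Jb a b =
  cw_lattice_sum J1 J2 Jb N n m a b / cw_lattice_sum J1 J2 Jb N n m p_infty p_infty.
Proof.
  intros HN Hn Hm.
  assert (Hnum : sum_configs n m (fun x y => cw_weight N J1 J2 Jb x y *
      (if Rle_dec (sumR x / sqrt (INR n)) a
       then if Rle_dec (sumR y / sqrt (INR m)) b then 1 else 0 else 0)) =
    lattice_norm n * lattice_norm m * cw_lattice_sum J1 J2 Jb N n m a b).
  { rewrite <- sum_configs_upto by assumption. f_equal.
    do 2 (apply functional_extensionality; intros ?). rewrite !indicator_upto_Finite.
    destruct (Rle_dec _ a); [destruct (Rle_dec _ b)|]; ring. }
  assert (HZ : cw_Z N n m J1 J2 Jb =
    lattice_norm n * lattice_norm m * cw_lattice_sum J1 J2 Jb N n m p_infty p_infty).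
  { rewrite <- sum_configs_upto by assumption. unfold cw_Z. f_equal.
    do 2 (apply functional_extensionality; intros ?). rewrite !indicator_upto_p_infty. ring. }
  unfold cw_cdf. rewrite Hnum, HZ. apply Rdiv_mult_l_l.
  pose proof (lattice_norm_pos n Hn). pose proof (lattice_norm_pos m Hm). nra.
Qed.

(** * The limit theorem *)

Lemma eventually_pos (n : nat -> nat) : filterlim n eventually eventually ->
  eventually (fun N => (0 < n N)%nat).
Proof. intros Hn. apply (Hn (fun k => (0 < k)%nat)). exists 1%nat. auto. Qed.

Section HighTemperature.

Variables (N1 N2 : nat -> nat) (a1 a2 J1 J2 Jb : R).
Hypothesis N1_infty : filterlim N1 eventually eventually.
Hypothesis N2_infty : filterlim N2 eventually eventually.
Hypothesis ratio1_cv : filterlim (fun N => ratio N (N1 N)) eventually (locally a1).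
Hypothesis ratio2_cv : filterlim (fun N => ratio N (N2 N)) eventually (locally a2).
Hypothesis a1_pos : 0 < a1.
Hypothesis a2_pos : 0 < a2.

Let A := 1 - a1 * J1.
Let B := 1 - a2 * J2.
Let c := sqrt (a1 * a2) * Jb.

Hypothesis A_pos : 0 < A.
Hypothesis B_pos : 0 < B.
Hypothesis det_pos : c ^ 2 < A * B.

Lemma filterlim_coupling :
  filterlim (fun N => coupling Jb N (N1 N) (N2 N)) eventually (locally c).
Proof.
  apply (filterlim_Rmult eventually); [|apply filterlim_const].
  apply (filterlim_continuous eventually _ sqrt).
  - apply continuity_pt_filterlim, continuity_pt_sqrt. nra.
  - apply (filterlim_Rmult eventually); assumption.
Qed.

Lemma cw_profile_cv : continuous_convergence2 eventually
  (fun N => cw_profile J1 J2 Jb N (N1 N) (N2 N)) (gauss2 A B c).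
Proof.
  intros x y. set (F := filter_prod (filter_prod eventually (locally x)) (locally y)).
  assert (HN : filterlim (fun p => fst (fst p)) F eventually)
    by exact (filterlim_comp _ _ _ fst fst _ _ _ filterlim_fst filterlim_fst).
  assert (Hx : filterlim (fun p => snd (fst p)) F (locally x))
    by exact (filterlim_comp _ _ _ fst snd _ _ _ filterlim_fst filterlim_snd).
  assert (Hy : filterlim snd F (locally y)) by exact filterlim_snd.
  assert (Hprofile : forall (n : nat -> nat) u z, filterlim n eventually eventually ->
      filterlim u F (locally z) ->
      filterlim (fun p => binom_profile (n (fst (fst p))) (u p)) F (locally (exp (- z ^ 2 / 2)))).
  { intros n u z Hn Hu. apply (filterlim_comp_2 (G := eventually) (H := locally z)
      (fun p => n (fst (fst p))) u binom_profile); [|exact Hu|apply binom_profile_cv].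
    exact (filterlim_comp _ _ _ _ n _ _ _ HN Hn). }
  assert (Hdiag : forall r a J, filterlim r eventually (locally a) ->
      filterlim (fun p => - (r (fst (fst p)) * J)) F (locally (- (a * J)))).
  { intros r a J Hr. apply (filterlim_comp _ _ _ _ (fun N => - (r N * J)) _ eventually _ HN).
    apply (filterlim_continuous eventually r (fun z => - (z * J))); [|exact Hr].
    continuous_by_derive. auto. }
  replace (gauss2 A B c x y) with
    (exp (- x ^ 2 / 2) * exp (- y ^ 2 / 2) * gauss2 (- (a1 * J1)) (- (a2 * J2)) c x y).
  - apply (filterlim_Rmult F); [apply (filterlim_Rmult F); apply Hprofile; assumption|].
    apply (filterlim_gauss2 F); try assumption.
    + exact (Hdiag (fun N => ratio N (N1 N)) a1 J1 ratio1_cv).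
    + exact (Hdiag (fun N => ratio N (N2 N)) a2 J2 ratio2_cv).
    + exact (filterlim_comp _ _ _ _ _ _ _ _ HN filterlim_coupling).
  - unfold A, B, Rminus. rewrite <- gauss2_tilt, !Rmult_1_r. reflexivity.
Qed.

Lemma cw_profile_dominated :
  exists K, eventually (fun N => cauchy_dominated2 K (cw_profile J1 J2 Jb N (N1 N) (N2 N))).
Proof.
  assert (Hdiag : forall n a J, filterlim n eventually eventually ->
      filterlim (fun N => ratio N (n N)) eventually (locally a) ->
      filterlim (fun N => shrink (n N) + - (ratio N (n N) * J)) eventually (locally (1 - a * J))).
  { intros n a J Hn Hr. apply (filterlim_Rplus eventually).
    - exact (filterlim_comp _ _ _ n shrink _ _ _ Hn filterlim_shrink).
    - apply (filterlim_continuous eventually _ (fun z => - (z * J))); [|exact Hr].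
      continuous_by_derive. auto. }
  destruct (eventually_gauss2_dominated eventually
    (fun N => shrink (N1 N) + - (ratio N (N1 N) * J1))
    (fun N => shrink (N2 N) + - (ratio N (N2 N) * J2))
    (fun N => coupling Jb N (N1 N) (N2 N)) A B c A_pos B_pos det_pos) as [K HK].
  - apply Hdiag; assumption.
  - apply Hdiag; assumption.
  - exact filterlim_coupling.
  - exists K. generalize (filter_and _ _ HK
      (filter_and _ _ (eventually_pos N1 N1_infty) (eventually_pos N2 N2_infty))).
    apply filter_imp. intros N [HN [Hn Hm]] x y.
    eapply Rle_trans; [apply abs_cw_profile_le; assumption|apply HN].
Qed.

Lemma cw_lattice_sum_cv (b1 b2 : Rbar) :
  filterlim (fun N => cw_lattice_sum J1 J2 Jb N (N1 N) (N2 N) b1 b2) eventually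
    (locally (improper_RInt2 (gauss2 A B c) b1 b2)).
Proof.
  destruct cw_profile_dominated as [K HK].
  apply (lattice_sum2_cv eventually (fun N => spin_lattice (N1 N)) (fun N => spin_lattice (N2 N))
    (fun N => cw_profile J1 J2 Jb N (N1 N) (N2 N)) (gauss2 A B c) K).
  - exact (refines_comp eventually eventually spin_lattice N1 N1_infty spin_lattice_refines).
  - exact (refines_comp eventually eventually spin_lattice N2 N2_infty spin_lattice_refines).
  - exact cw_profile_cv.
  - exact HK.
Qed.

Theorem cw_cdf_cv (a b : R) : (forall N, (N1 N + N2 N <= N)%nat) ->
  is_lim_seq (fun N => cw_cdf N (N1 N) (N2 N) J1 J2 Jb a b)
    (improper_RInt2 (gauss2 A B c) a b / improper_RInt2 (gauss2 A B c) p_infty p_infty).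
Proof.
  intros Hsize. pose proof PI_RGT_0 as Hpi.
  apply is_lim_seq_ext_loc with (fun N => cw_lattice_sum J1 J2 Jb N (N1 N) (N2 N) a b /
    cw_lattice_sum J1 J2 Jb N (N1 N) (N2 N) p_infty p_infty).
  - generalize (filter_and _ _ (eventually_pos N1 N1_infty) (eventually_pos N2 N2_infty)).
    apply filter_imp. intros N [Hn Hm]. specialize (Hsize N). symmetry.
    apply cw_cdf_lattice_sum; lia.
  - apply is_lim_seq_div'; [apply cw_lattice_sum_cv|apply cw_lattice_sum_cv|].
    rewrite gauss2_mass by assumption.
    apply Rgt_not_eq, Rdiv_lt_0_compat; [lra|apply sqrt_lt_R0; lra].
Qed.

End HighTemperature.

Lemma nat_to_infty_filterlim (u : nat -> nat) : nat_to_infty u -> filterlim u eventually eventually.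
Proof.
  intros H P [M HM]. destruct (H M) as [n0 Hn]. exists n0. intros n Hn'. apply HM, Hn, Hn'.
Qed.

Lemma sqr_sqrt_mult (p q : R) : 0 <= p -> (sqrt p * q) ^ 2 = p * q ^ 2.
Proof. intros Hp. rewrite Rpow_mult_distr, pow2_sqrt by exact Hp. reflexivity. Qed.

Lemma high_temperature_pos_def (a1 a2 J1 J2 Jb : R) : 0 < a1 -> 0 < a2 ->
  J1 < / a1 -> J2 < / a2 -> Jb ^ 2 < (/ a1 - J1) * (/ a2 - J2) ->
  0 < 1 - a1 * J1 /\ 0 < 1 - a2 * J2 /\
  (sqrt (a1 * a2) * Jb) ^ 2 < (1 - a1 * J1) * (1 - a2 * J2).
Proof.
  intros Ha1 Ha2 HJ1 HJ2 HJb. rewrite sqr_sqrt_mult by nra.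
  replace (1 - a1 * J1) with (a1 * (/ a1 - J1)) by (field; lra).
  replace (1 - a2 * J2) with (a2 * (/ a2 - J2)) by (field; lra).
  split; [apply Rmult_lt_0_compat; lra|split; [apply Rmult_lt_0_compat; lra|]].
  replace (a1 * (/ a1 - J1) * (a2 * (/ a2 - J2)))
    with (a1 * a2 * ((/ a1 - J1) * (/ a2 - J2))) by ring.
  apply Rmult_lt_compat_l; [apply Rmult_lt_0_compat; assumption|exact HJb].
Qed.

Theorem theorem2
  (N1 N2 : nat -> nat) (a1 a2 J1 J2 Jb : R)
  (hsize : forall N, (N1 N + N2 N <= N)%nat)
  (hN1 : nat_to_infty N1) (hN2 : nat_to_infty N2)
  (ha1 : Un_cv (fun N => INR (N1 N) / INR N) a1)
  (ha2 : Un_cv (fun N => INR (N2 N) / INR N) a2)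
  (hJ1 : 0 < J1) (hJ2 : 0 < J2) (hJb : 0 < Jb)
  (hDelta : J1 * J2 - Jb ^ 2 > 0)
  (ha1pos : 0 < a1) (ha2pos : 0 < a2)
  (hT1 : J1 < / a1) (hT2 : J2 < / a2)
  (hT12 : Jb ^ 2 < (/ a1 - J1) * (/ a2 - J2)) :
  forall a b : R, exists v : R,
    is_gauss2_cdf (C11 a1 a2 J1 J2 Jb) (C12 a1 a2 J1 J2 Jb) (C22 a1 a2 J1 J2 Jb) a b v /\
    Un_cv (fun N => cw_cdf N (N1 N) (N2 N) J1 J2 Jb a b) v.
Proof.
  intros a b.
  destruct (high_temperature_pos_def a1 a2 J1 J2 Jb) as [HA [HB Hdet]]; try assumption.
  set (gauss := gauss2 (1 - a1 * J1) (1 - a2 * J2) (sqrt (a1 * a2) * Jb)).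
  exists (improper_RInt2 gauss a b / improper_RInt2 gauss p_infty p_infty). split.
  - unfold C11, C12, C22, C_den. rewrite <- sqr_sqrt_mult by nra.
    apply is_gauss2_cdf_improper_RInt2; assumption.
  - apply is_lim_seq_Reals, cw_cdf_cv; try assumption.
    + apply nat_to_infty_filterlim, hN1.
    + apply nat_to_infty_filterlim, hN2.
    + apply is_lim_seq_Reals in ha1. exact ha1.
    + apply is_lim_seq_Reals in ha2. exact ha2.
Qed.
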